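(* Let $\mathbb{F}$ be a field, $n\ge 2$, and $V$ a $2n$-dimensional $\mathbb{F}$-vector space with a non-degenerate alternating bilinear form $\mathsf{s}$, with hyperbolic basis $\mathcal{H}=\{e_i,f_i\}_{i=1}^n$, and let $G=\mathrm{Sp}(V)$. Let $\mathcal{A}^\pi$ be the amalgam of subgroups of $G$ consisting of the groups $S^\pi_j$ $(1\le j\le n)$, $M^\pi_i$ $(1\le i\le n-1)$, $S^\pi_{jl}=\langle S^\pi_j,S^\pi_l\rangle$ $(1\le j\neq l\le n)$, $M^\pi_{ik}=\langle M^\pi_i,M^\pi_k\rangle$ $(1\le i\ne k\le n-1)$ and $Q^\pi_{ij}=\langle M^\pi_i,S^\pi_j\rangle$ $(1\le i\le n-1,\ 1\le j\le n)$, together with the inclusion maps among them induced by $G$, where $S^\pi_j$ is the set of $g\in G$ fixing every vector of $\mathcal{H}\setminus\{e_j,f_j\}$ and stabilizing $\langle e_j,f_j\rangle$, and $M^\pi_i$ is the set of $g\in G$ fixing every vector of $\mathcal{H}\setminus\{f_i,f_{i+1}\}$ and stabilizing $\langle e_i,f_i,e_{i+1},f_{i+1}\rangle$. If $|\mathbb{F}|>2$, then $G=\mathrm{Sp}(V)$ is the universal completion of $\mathcal{A}^\pi$. Moreover, for any field $\mathbb{F}$, $\mathrm{Sp}(V)$ is the universal completion of the amalgam of maximal parabolic subgroups $P_{I\setminus\{k\}}=\mathrm{Stab}_G(C_k)$, $k\in I=\{1,\dots,2n-1\}$, for the action of $G$ on the geometry $\Gamma(V)$ with respect to the standard chamber 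$C=\{C_k\}_{k=1}^{2n-1}$.
   Context: $\mathrm{Sp}(V)$ is the group of linear automorphisms of $V$ preserving $\mathsf{s}$. A hyperbolic basis satisfies $\mathsf{s}(e_i,e_j)=\mathsf{s}(f_i,f_j)=0$, $\mathsf{s}(e_i,f_j)=\delta_{ij}$. For subspaces, $U^\perp=\{v:\mathsf{s}(u,v)=0\ \forall u\in U\}$ and $\mathrm{Rad}(U)=U\cap U^\perp$. The geometry $\Gamma(V)$: for $k\in I=\{1,\dots,2n-1\}$ the objects of type $k$ are the $k$-dimensional subspaces $U\le V$ with $\dim\mathrm{Rad}(U)\le 1$; two objects $X,Y$ are incident iff $X=Y$, or $X\subseteq Y$ and $X\cap\mathrm{Rad}(Y)=0$, or $Y\subseteq X$ and $Y\cap \mathrm{Rad}(X)=0$. Setting $h_{2i-1}=e_i$, $h_{2i}=f_i$, the standard chamber is $C_k=\langle h_1,\dots,h_k\rangle$, $1\le k\le 2n-1$. Universal completion: given a family of subgroups $\{X_a\}$ of a group $G$ (an amalgam with inclusion maps induced by $G$), its universal completion is the group generated by the elements of $\bigcup_a X_a$ subject to all relations $xy=z$ holding inside some $X_a$; ''$G$ is the universal completion'' means the natural map from this group to $G$ is an isomorphism. *)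

(* Defs.v *)
From HB Require Import structures.
From mathcomp Require Import all_boot all_order all_algebra.
Set Implicit Arguments. Unset Strict Implicit. Unset Printing Implicit Defensive.
Import GRing.Theory.
Local Open Scope ring_scope.

Record abs_group := AbsGroup {
  ag_car :> Type;
  ag_mul : ag_car -> ag_car -> ag_car;
  ag_one : ag_car;
  ag_inv : ag_car -> ag_car;
  ag_mulA : forall x y z, ag_mul x (ag_mul y z) = ag_mul (ag_mul x y) z;
  ag_mul1 : forall x, ag_mul ag_one x = x;
  ag_mulV : forall x, ag_mul (ag_inv x) x = ag_one }.

Section Completion.
Variables (T : Type) (mul : T -> T -> T) (one : T) (inv : T -> T).

Inductive gen_by (A : T -> Prop) : T -> Prop :=
  | gen_in x : A x -> gen_by A x
  | gen_one : gen_by A one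
  | gen_mul x y : gen_by A x -> gen_by A y -> gen_by A (mul x y)
  | gen_inv x : gen_by A x -> gen_by A (inv x).

(* G (a group, inside the ambient monoid T) is the universal completion of *)
(* the amalgam of subgroups X a (a : I) of G: the natural map from the      *)
(* group presented by generators (elements of the union of the X a) and     *)
(* relations (x y = z holding in some X a) to G is an isomorphism.          *)
(* Equivalently (standard): G is generated by the union, and every map f   *)
(* from the union to a group H respecting all relations x y = xy inside    *)
(* each X a extends to a homomorphism G -> H.                               *)
Definition universal_completion (G : T -> Prop) (I : Type)
    (X : I -> T -> Prop) : Prop :=
  (forall g, G g -> gen_by (fun x => exists a, X a x) g) /\
  forall (H : abs_group) (f : T -> H),
    (forall a x y, X a x -> X a y -> f (mul x y) = ag_mul (f x) (f y)) ->
    exists phi : T -> H,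
      (forall g g', G g -> G g' -> phi (mul g g') = ag_mul (phi g) (phi g')) /\
      (forall a x, X a x -> phi x = f x).
End Completion.

Section Symplectic.
Variables (F : fieldType) (V : vectType F).

Definition symplectic_form (s : V -> V -> F) : Prop :=
  [/\ (forall a u v w, s (a *: u + v) w = a * s u w + s v w),
      (forall a u v w, s w (a *: u + v) = a * s w u + s w v),
      (forall v, s v v = 0) &
      (forall u, (forall v, s u v = 0) -> u = 0)].

(* h (2k) = e_(k+1), h (2k+1) = f_(k+1)  (0-based indexing, k < n) *)
Definition hyperbolic_basis (s : V -> V -> F) (n : nat) (h : nat -> V) : Prop :=
  basis_of fullv (mkseq h (2 * n)) /\
  forall i j, (i < n)%N -> (j < n)%N ->
    [/\ s (h (2 * i)%N) (h (2 * j)%N) = 0,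
        s (h (2 * i).+1) (h (2 * j).+1) = 0 &
        s (h (2 * i)%N) (h (2 * j).+1) = (i == j)%:R].

Definition lmul (g g' : 'End(V)) : 'End(V) := (g \o g')%VF.
Definition lone : 'End(V) := \1%VF.
Definition linv (g : 'End(V)) : 'End(V) := (g^-1)%VF.

Definition Sp (s : V -> V -> F) : 'End(V) -> Prop :=
  fun g => bijective (fun v => g v) /\ forall u v, s (g u) (g v) = s u v.

Definition S_pi s n (h : nat -> V) (j : nat) : 'End(V) -> Prop :=
  fun g => [/\ Sp s g,
    (forall k, (k < n)%N -> k != j ->
       g (h (2 * k)%N) = h (2 * k)%N /\ g (h (2 * k).+1) = h (2 * k).+1) &
    (g @: <<[:: h (2 * j)%N; h (2 * j).+1]>> =
          <<[:: h (2 * j)%N; h (2 * j).+1]>>)%VS].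

Definition M_pi s n (h : nat -> V) (i : nat) : 'End(V) -> Prop :=
  fun g => [/\ Sp s g,
    (forall k, (k < n)%N -> g (h (2 * k)%N) = h (2 * k)%N),
    (forall k, (k < n)%N -> k != i -> k != i.+1 -> g (h (2 * k).+1) = h (2 * k).+1) &
    (g @: <<[:: h (2 * i)%N; h (2 * i).+1; h (2 * i.+1)%N; h (2 * i.+1).+1]>> =
          <<[:: h (2 * i)%N; h (2 * i).+1; h (2 * i.+1)%N; h (2 * i.+1).+1]>>)%VS].

Definition gen2 (A B : 'End(V) -> Prop) : 'End(V) -> Prop :=
  gen_by lmul lone linv (fun x => A x \/ B x).

Inductive pi_index :=
  | PiS of nat | PiM of nat | PiSS of nat & nat | PiMM of nat & nat
  | PiQ of nat & nat.

Definition pi_valid (n : nat) (a : pi_index) : bool :=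
  match a with
  | PiS j => (j < n)%N
  | PiM i => (i.+1 < n)%N
  | PiSS j l => [&& (j < n)%N, (l < n)%N & j != l]
  | PiMM i k => [&& (i.+1 < n)%N, (k.+1 < n)%N & i != k]
  | PiQ i j => (i.+1 < n)%N && (j < n)%N
  end.

Definition pi_amalgam s n (h : nat -> V) (a : {a : pi_index | pi_valid n a})
  : 'End(V) -> Prop :=
  match sval a with
  | PiS j => S_pi s n h j
  | PiM i => M_pi s n h i
  | PiSS j l => gen2 (S_pi s n h j) (S_pi s n h l)
  | PiMM i k => gen2 (M_pi s n h i) (M_pi s n h k)
  | PiQ i j => gen2 (M_pi s n h i) (S_pi s n h j)
  end.

Definition std_chamber (h : nat -> V) (k : nat) : {vspace V} := <<mkseq h k>>%VS.

Definition parabolic_amalgam s n (h : nat -> V)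
  (k : {k : nat | (0 < k < 2 * n)%N}) : 'End(V) -> Prop :=
  fun g => Sp s g /\ (g @: std_chamber h (sval k))%VS = std_chamber h (sval k).

End Symplectic.

Arguments S_pi {F V} s n h j _.
Arguments M_pi {F V} s n h i _.
Arguments pi_amalgam {F V} s n h a _.
Arguments parabolic_amalgam {F V} s n h k _.
Arguments hyperbolic_basis {F V} s n h.

(* Main.v *)
(** Write T(x,a) for the transvection v |-> v + a s(x,v) x. The engine is a presentation: if an
    assignment tau(x,a) in a group satisfies the conjugation relations of the T(x,a), and every word
    in the tau(x,a) with x orthogonal to one fixed vector e is trivial as soon as the corresponding
    product of transvections is, then the same holds for all words. Indeed the graph on nonzero
    vectors joining v and w when s(v,w) <> 0 is simply connected modulo triangles, each edge carries a
    unique transvection, and the transvections of a triangle lie in the stabilizer of a common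
    orthogonal vector (here n >= 2 is used).

    To define tau from an amalgam, split V = A + W with A = <e,f> a hyperbolic plane and W its
    orthogonal complement. A homomorphism on the stabilizer of e and a homomorphism on Sp(A) that fit
    together give tau(v,a) for every v, because Sp(A) moves the A-component of v to e. The relation
    for (u,v) is clear when the A-components of u and v are orthogonal, and the other cases are
    reduced to this one and to those where the W-components are proportional (or orthogonal).

    For the maximal parabolics these last cases lie in the stabilizer of e_n. For the slim amalgam one
    argues by induction on n: Sp(W) is known, and the stabilizer of e is an extension of Sp(W) by a
    Heisenberg group on W, rebuilt from the conjugates of a single short root group; orthogonal vectors
    u, v in W are handled through a third vector pairing nontrivially with u, v and u + v, which exists
    because |F| > 2. *)

Require Import Defs.
From HB Require Import structures.
From mathcomp Require Import all_boot all_order all_algebra.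
From mathcomp Require Import ring zify.
From Stdlib Require Import Classical ClassicalEpsilon ProofIrrelevance.
Set Implicit Arguments. Unset Strict Implicit. Unset Printing Implicit Defensive.
Import GRing.Theory.
Local Open Scope ring_scope.

(** * Transvections generate the symplectic group *)

Notation "x ** y" := (ag_mul x y) (at level 40, left associativity).
Notation "x ^i" := (ag_inv x) (at level 2, left associativity, format "x ^i").

Section AbstractGroup.
Variable H : abs_group.
Implicit Types x y z : H.

Lemma agA x y z : (x ** y) ** z = x ** (y ** z).
Proof. by rewrite ag_mulA. Qed.

Lemma agVK x y : x^i ** (x ** y) = y.
Proof. by rewrite ag_mulA ag_mulV ag_mul1. Qed.

Lemma agI x y z : x ** y = x ** z -> y = z.
Proof. by move=> e; rewrite -(agVK x y) e agVK. Qed.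

Lemma agV x : x ** x^i = ag_one H.
Proof. by rewrite -(ag_mul1 (x ** x^i)) -(ag_mulV x^i) agA (agVK x). Qed.

Lemma ag1 x : x ** ag_one H = x.
Proof. by apply: (@agI x^i); rewrite agVK ag_mulV. Qed.

Lemma agKV x y : x ** (x^i ** y) = y.
Proof. by rewrite ag_mulA agV ag_mul1. Qed.

Lemma agVr x y : x ** y = ag_one H -> y = x^i.
Proof. by move=> e; rewrite -(agVK x y) e ag1. Qed.

Lemma agVV x : x^i^i = x.
Proof. by apply/esym/agVr/ag_mulV. Qed.

Lemma agVM x y : (x ** y)^i = y^i ** x^i.
Proof. by apply/esym/agVr; rewrite agA agKV agV. Qed.

Lemma agV1 : (ag_one H)^i = ag_one H.
Proof. by apply/esym/agVr/ag_mul1. Qed.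

Definition agN := (agA, agVM, agVV, agV1, agVK, agKV, agV, ag_mulV, ag1, ag_mul1).

Definition cj x y := x ** y ** x^i.

Lemma cjM x y z : cj x (y ** z) = cj x y ** cj x z.
Proof. by rewrite /cj !agN. Qed.

Lemma cjMl x y z : cj (x ** y) z = cj x (cj y z).
Proof. by rewrite /cj !agN. Qed.

Lemma cjV x y : cj x (y^i) = (cj x y)^i.
Proof. by rewrite /cj !agN. Qed.

Lemma cj1 x : cj x (ag_one H) = ag_one H.
Proof. by rewrite /cj !agN. Qed.

Lemma cjJ x y z : cj x (cj y z) = cj (cj x y) (cj x z).
Proof. by rewrite /cj !agN. Qed.

Lemma cjK x y : cj x^i (cj x y) = y.
Proof. by rewrite /cj !agN. Qed.

Lemma cjVK x y : cj x (cj x^i y) = y.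
Proof. by rewrite /cj !agN. Qed.

Lemma cj_commute x y : x ** y = y ** x -> cj x y = y.
Proof. by rewrite /cj => ->; rewrite !agN. Qed.

Lemma commute_cj x y : cj x y = y -> x ** y = y ** x.
Proof. by rewrite /cj => e; rewrite -{2}e !agN. Qed.
End AbstractGroup.

Section Lmul.
Variables (F : fieldType) (V : vectType F).

Lemma lmulE (f g : 'End(V)) v : lmul f g v = f (g v).
Proof. exact: comp_lfunE. Qed.

Lemma lmulA (f g k : 'End(V)) : lmul f (lmul g k) = lmul (lmul f g) k.
Proof. by apply/lfunP => v; rewrite !lmulE. Qed.

Lemma loneE v : lone V v = v.
Proof. exact: id_lfunE. Qed.

Lemma lmul1 (f : 'End(V)) : lmul (lone V) f = f.
Proof. by apply/lfunP => v; rewrite lmulE loneE. Qed.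

Lemma lmulr1 (f : 'End(V)) : lmul f (lone V) = f.
Proof. by apply/lfunP => v; rewrite lmulE loneE. Qed.

(** Packing the linearity proof on the fly lets transvections, Eichler maps and extensions from a
    summand be defined as [linfun] of plain functions. *)
Lemma linear_lfun (f : V -> V) : linear f -> linfun f =1 f.
Proof.
move=> lf v; pose m := GRing.isLinear.Build _ _ _ _ f lf.
pose L : {linear V -> V} := HB.pack f m.
exact: (lfunE L v).
Qed.

Definition group_pred (K : 'End(V) -> Prop) :=
  [/\ K (lone V), (forall f g, K f -> K g -> K (lmul f g))
    & (forall f, K f -> K (linv f))].

Definition hom_on (H : abs_group) (K : 'End(V) -> Prop) (f : 'End(V) -> H) :=
  forall g g', K g -> K g' -> f (lmul g g') = f g ** f g'.

End Lmul.
Arguments lone {F V}.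

(** * Isometries, transvections and the groups they generate *)

Section Form.
Variables (F : fieldType) (V : vectType F) (s : V -> V -> F).
Hypothesis hs : symplectic_form s.
Implicit Types (u v w x y : V) (a b c : F) (f g k : 'End(V)).

Lemma ss v : s v v = 0. Proof. by case: hs. Qed.
Lemma sDl u v w : s (u + v) w = s u w + s v w.
Proof. by case: hs => h _ _ _; rewrite -{1}(scale1r u) h mul1r. Qed.
Lemma sDr u v w : s w (u + v) = s w u + s w v.
Proof. by case: hs => _ h _ _; rewrite -{1}(scale1r u) h mul1r. Qed.
Lemma s0l w : s 0 w = 0.
Proof. by apply: (addrI (s 0 w)); rewrite -sDl !addr0. Qed.
Lemma s0r w : s w 0 = 0.
Proof. by apply: (addrI (s w 0)); rewrite -sDr !addr0. Qed.
Lemma sZl a u w : s (a *: u) w = a * s u w.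
Proof. by case: hs => h _ _ _; rewrite -{1}(addr0 (a *: u)) h s0l addr0. Qed.
Lemma sZr a u w : s w (a *: u) = a * s w u.
Proof. by case: hs => _ h _ _; rewrite -{1}(addr0 (a *: u)) h s0r addr0. Qed.
Lemma sNl u w : s (- u) w = - s u w.
Proof. by rewrite -scaleN1r sZl mulN1r. Qed.
Lemma sNr u w : s w (- u) = - s w u.
Proof. by rewrite -scaleN1r sZr mulN1r. Qed.
Lemma sC u v : s u v = - s v u.
Proof.
have := ss (u + v); rewrite sDl !sDr !ss add0r addr0 => /eqP.
by rewrite addr_eq0 => /eqP.
Qed.
Definition sE := (sDl, sDr, sNl, sNr, sZl, sZr, s0l, s0r, ss).

Lemma sC0 u v : s u v = 0 -> s v u = 0.
Proof. by rewrite sC => /eqP; rewrite oppr_eq0 => /eqP. Qed.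

Lemma sC_neq0 u v : (s u v != 0) = (s v u != 0).
Proof. by rewrite sC oppr_eq0. Qed.

(* Nondegeneracy turns identities between vectors into scalar ones, which [ring] and [field] can prove. *)
Lemma s_inj u v : (forall w, s w u = s w v) -> u = v.
Proof.
move=> e; apply/eqP; rewrite -subr_eq0; apply/eqP; case: hs => _ _ _; apply=> w.
by rewrite sC sDr sNr e subrr oppr0.
Qed.

Lemma nondeg u : u != 0 -> exists w, s u w != 0.
Proof.
move=> u0; have [w sw|/(_ _)h] := pickP (fun i : 'I_(\dim {:V}) => s u (tnth (vbasis {:V}) i) != 0).
  by exists (tnth (vbasis {:V}) w).
case/eqP: u0; case: hs => _ _ _; apply=> v.
rewrite (coord_vbasis (memvf v)); elim/big_rec: _ => [|i x _ IH]; first by rewrite s0r.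
rewrite sDr sZr IH addr0.
have := h i; rewrite (tnth_nth 0) => /negbFE/eqP->; exact: mulr0.
Qed.

Lemma iso_ker0 g : (forall u v, s (g u) (g v) = s u v) -> lker g = 0%VS.
Proof.
move=> gi; apply/eqP/lker0P => u v e; apply: s_inj => w.
by rewrite -gi e gi.
Qed.

(** Nondegeneracy makes an isometry injective, and an injective endomorphism in finite dimension is
    bijective. *)
Lemma SpP g : (forall u v, s (g u) (g v) = s u v) -> Sp s g.
Proof.
move=> gi; split=> //; have k0 : lker g == 0%VS by rewrite iso_ker0.
by exists (g^-1)%VF => v; [rewrite lker0_lfunK | rewrite lker0_lfunVK].
Qed.

Lemma Sp_iso g u v : Sp s g -> s (g u) (g v) = s u v.
Proof. by case. Qed.

Lemma Sp_ker g : Sp s g -> lker g == 0%VS.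
Proof. by case=> _ gi; rewrite iso_ker0. Qed.

Lemma linvK g v : Sp s g -> linv g (g v) = v.
Proof. by move=> /Sp_ker/lker0_lfunK; apply. Qed.

Lemma linvVK g v : Sp s g -> g (linv g v) = v.
Proof. by move=> /Sp_ker/lker0_lfunVK; apply. Qed.

Lemma lmulV g : Sp s g -> lmul (linv g) g = lone.
Proof. by move=> Sg; apply/lfunP => v; rewrite lmulE loneE linvK. Qed.

Lemma lmulVr g : Sp s g -> lmul g (linv g) = lone.
Proof. by move=> Sg; apply/lfunP => v; rewrite lmulE loneE linvVK. Qed.

Lemma Sp_group : group_pred (Sp s).
Proof.
split=> [|f g Sf Sg|f Sf]; apply: SpP => u v.
- by rewrite !loneE.
- by rewrite !lmulE !Sp_iso.
- by rewrite -(Sp_iso _ _ Sf) !linvVK.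
Qed.

Lemma Sp1 : Sp s lone. Proof. by case: Sp_group. Qed.
Lemma SpM f g : Sp s f -> Sp s g -> Sp s (lmul f g).
Proof. by case: Sp_group => _ h _; apply: h. Qed.
Lemma SpV f : Sp s f -> Sp s (linv f). Proof. by case: Sp_group => _ _; apply. Qed.

Lemma linv_fix g v : Sp s g -> g v = v -> linv g v = v.
Proof. by move=> Sg e; rewrite -{1}e linvK. Qed.

Lemma Sp_neq0 g v : Sp s g -> v != 0 -> g v != 0.
Proof. by move=> Sg; apply: contra => /eqP e; rewrite -(linvK v Sg) e linear0. Qed.

Lemma Sp_inj g u v : Sp s g -> g u = g v -> u = v.
Proof. by move=> Sg e; rewrite -(linvK u Sg) e linvK. Qed.

Section Hom.
Variables (H : abs_group) (K : 'End(V) -> Prop) (f : 'End(V) -> H).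
Hypotheses (KS : forall g, K g -> Sp s g) (Kg : group_pred K) (fK : hom_on K f).

Lemma hom1 : f lone = ag_one H.
Proof. by case: Kg => K1 _ _; apply: (@agI _ (f lone)); rewrite -fK // lmul1 ag1. Qed.

Lemma homV g : K g -> f (linv g) = (f g)^i.
Proof.
by move=> Kg'; apply: agVr; rewrite -fK ?lmulVr ?hom1 //; [apply: KS | case: Kg => _ _; apply].
Qed.

Lemma homJ k g : K k -> K g -> f (lmul (lmul k g) (linv k)) = cj (f k) (f g).
Proof. by case: Kg => _ KM KV Kk Kg'; rewrite !fK ?homV //; [apply: KM|apply: KV]. Qed.
End Hom.

Definition tv x a : 'End(V) := linfun (fun v => v + (a * s x v) *: x).

Lemma tvE x a v : tv x a v = v + (a * s x v) *: x.
Proof.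
rewrite linear_lfun // => c u w; rewrite sDr sZr mulrDr scalerDl scalerDr scalerA.
by rewrite [a * (c * _)]mulrCA addrACA.
Qed.

Lemma tv_Sp x a : Sp s (tv x a).
Proof. by apply: SpP => u v; rewrite !tvE !sE (sC u x); ring. Qed.

Lemma tvD x a b : tv x (a + b) = lmul (tv x a) (tv x b).
Proof. by apply/lfunP => v; rewrite lmulE; apply: s_inj => w; rewrite !tvE !sE; ring. Qed.

Lemma tvx0 x : tv x 0 = lone.
Proof. by apply/lfunP => v; rewrite tvE loneE mul0r scale0r addr0. Qed.

Lemma tv0 a : tv 0 a = lone.
Proof. by apply/lfunP => v; rewrite tvE loneE scaler0 addr0. Qed.

Lemma tvZ c x a : tv (c *: x) a = tv x (c ^+ 2 * a).
Proof. by apply/lfunP => v; apply: s_inj => w; rewrite !tvE !sE; ring. Qed.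

Lemma tv_fix x a v : s x v = 0 -> tv x a v = v.
Proof. by move=> e; rewrite tvE e mulr0 scale0r addr0. Qed.

Lemma tvV x a : linv (tv x a) = tv x (- a).
Proof.
apply/lfunP => v; rewrite -{1}[v](linvVK v (tv_Sp x a)).
rewrite -[LHS]loneE -(tvx0 x) -(addNr a) tvD lmulE !linvVK //; exact: tv_Sp.
Qed.

Lemma tvJ g x a : Sp s g -> lmul (lmul g (tv x a)) (linv g) = tv (g x) a.
Proof.
move=> Sg; apply/lfunP => v; rewrite !lmulE !tvE linearD linearZ /= linvVK //.
by rewrite -(Sp_iso _ _ Sg) linvVK.
Qed.

Lemma tvJ' g x a : Sp s g -> lmul g (tv x a) = lmul (tv (g x) a) g.
Proof. by move=> Sg; rewrite -tvJ // -lmulA lmulV // lmulr1. Qed.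

(** This is the transvection attached to an edge of the graph: its direction has to be proportional
    to [w - v], and then the scalar is forced. *)
Lemma tv_move v w : s w v != 0 -> tv (w - v) (s w v)^-1 v = w.
Proof. by move=> h; rewrite tvE !sE subr0 mulVf // scale1r addrC subrK. Qed.

Definition TG (Q : V -> Prop) : 'End(V) -> Prop :=
  gen_by (@lmul F V) lone (@linv F V) (fun g => exists x a, Q x /\ g = tv x a).

Lemma TG_tv (Q : V -> Prop) x a : Q x -> TG Q (tv x a).
Proof. by move=> Qx; apply: gen_in; exists x, a. Qed.

Lemma TG_M (Q : V -> Prop) f g : TG Q f -> TG Q g -> TG Q (lmul f g).
Proof. exact: gen_mul. Qed.

Lemma TG_Sp Q g : TG Q g -> Sp s g.
Proof.
elim=> [{}g [x [a [_ ->]]]||f {}g _ Sf _ Sg|f _ Sf];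
  [exact: tv_Sp | exact: Sp1 | exact: SpM | exact: SpV].
Qed.

Lemma TG_mono (Q Q' : V -> Prop) g : (forall x, Q x -> Q' x) -> TG Q g -> TG Q' g.
Proof.
move=> QQ; elim=> [{}g [x [a [Qx ->]]]||f {}g _ Sf _ Sg|f _ Sf].
- exact/TG_tv/QQ.
- exact: gen_one.
- exact: gen_mul.
- exact: gen_inv.
Qed.

Lemma TG_fix Q g v : (forall x, Q x -> s x v = 0) -> TG Q g -> g v = v.
Proof.
move=> Qv; elim=> [{}g [x [a [Qx ->]]]||f {}g _ Sf _ Sg|f Tf Sf].
- exact/tv_fix/Qv.
- exact: loneE.
- by rewrite lmulE Sg.
- exact/linv_fix/Sf/TG_Sp/Tf.
Qed.

Lemma TG_ind (Q : V -> Prop) (K : 'End(V) -> Prop) : group_pred K ->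
  (forall x a, Q x -> K (tv x a)) -> forall g, TG Q g -> K g.
Proof.
by move=> [K1 KM KV] Kt g; elim=> [{}g [x [a [Qx ->]]]||f {}g _ Sf _ Sg|f Tf Sf]; auto.
Qed.

(** Serves to compare homomorphisms with different domains on a group known to be generated by
    transvections. *)
Lemma TG_agree (H : abs_group) (Q : V -> Prop) (K K' : 'End(V) -> Prop) (f f' : 'End(V) -> H) :
  group_pred K -> group_pred K' -> hom_on K f -> hom_on K' f' ->
  (forall x a, Q x -> [/\ K (tv x a), K' (tv x a) & f (tv x a) = f' (tv x a)]) ->
  forall g, TG Q g -> [/\ K g, K' g & f g = f' g].
Proof.
move=> Kg Kg' fK fK' ft g; have [K1 KM KV] := Kg; have [K1' KM' KV'] := Kg'.
(* [homV] asks for a group of isometries, which [K] and [K'] are not assumed to be, so both are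
   intersected with [Sp s]. *)
have Gg (K0 : 'End(V) -> Prop) : group_pred K0 -> group_pred (fun g => Sp s g /\ K0 g).
  case=> a b c; split; first by split; [exact: Sp1|].
    by move=> ? ? [? ?] [? ?]; split; [exact: SpM|auto].
  by move=> ? [? ?]; split; [exact: SpV|auto].
have Gs (K0 : 'End(V) -> Prop) (f0 : 'End(V) -> H) : hom_on K0 f0 -> hom_on (fun g => Sp s g /\ K0 g) f0.
  by move=> h ? ? [? ?] [? ?]; apply: h.
suff: Sp s g -> TG Q g -> [/\ K g, K' g & f g = f' g] by move=> h Tg; apply: h => //; apply: TG_Sp Tg.
move=> _; elim=> [{}g [x [a [Qx ->]]]||k {}g _ [? ? e] _ [? ? e']|k Tk [? ? e]].
- exact: ft.
- split=> //; rewrite (hom1 Kg fK) //; exact/esym/(hom1 Kg' fK').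
- by split; auto; rewrite fK // fK' // e e'.
- have Sk := TG_Sp Tk; split; auto.
  have P1 K0 : forall k0, Sp s k0 /\ K0 k0 -> Sp s k0 by move=> ? [].
  by rewrite (homV (P1 _) (Gg _ Kg) (Gs _ _ fK)) // (homV (P1 _) (Gg _ Kg') (Gs _ _ fK')) // e.
Qed.

(* If [g] moves no vector [v] to one not orthogonal to [v], then [s (g v - v) w] is alternating in
   [v, w]; premultiplying by a transvection along some [g v - v] breaks this without shrinking the fixed space. *)
Lemma Sp_generated (Z : {vspace V}) g :
  Sp s g -> (forall z, z \in Z -> g z = z) ->
  TG (fun x => forall z, z \in Z -> s x z = 0) g.
Proof.
have [m] := ubnP (\dim {:V} - \dim Z); elim: m Z g => // m IH Z g ltm Sg gZ.
(* The transvection [t] carries [w] to [k w] and fixes [Z], so the inverse of [t] times [k] fixes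
   the larger space [Z + <w>], and induction applies. *)
have step w k : Sp s k -> (forall z, z \in Z -> k z = z) -> s (k w) w != 0 ->
  TG (fun x => forall z, z \in Z -> s x z = 0) k.
  move=> Sk kZ nz; have wZ : w \notin Z by apply: contra nz => /kZ->; rewrite ss.
  have kw : forall z, z \in Z -> s (k w - w) z = 0.
    by move=> z zZ; rewrite !sE -{1}(kZ z zZ) Sp_iso // subrr.
  pose t := tv (k w - w) (s (k w) w)^-1.
  rewrite (_ : k = lmul t (lmul (linv t) k)); last first.
    by rewrite lmulA lmulVr ?lmul1 //; apply: tv_Sp.
  apply: TG_M; first exact: TG_tv.
  have dZ : (\dim Z < \dim (Z + <[w]>))%N.
    rewrite ltnNge; apply: contra wZ => le; have /eqP -> : (Z == Z + <[w]>)%VS.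
      by rewrite eqEdim addvSl.
    by rewrite memvE addvSr.
  apply: (@TG_mono (fun x => forall z, z \in (Z + <[w]>)%VS -> s x z = 0)).
    by move=> x Hx z zZ; apply: Hx; rewrite memvE (subv_trans _ (addvSl _ _)) // -memvE.
  apply: IH.
  - have := dimvS (subvf (Z + <[w]>)%VS); rewrite ltnS in ltm; move: ltm dZ.
    move: (\dim {:V}) (\dim Z) (\dim (Z + _)) => a b c; lia.
  - by apply: SpM => //; apply/SpV/tv_Sp.
  - move=> z /memv_addP[z1 z1Z [z2 /vlineP[c ->] ->]]; rewrite lmulE !linearD !linearZ /= kZ //.
    congr (_ + _ *: _).
      by rewrite linv_fix //; [apply: tv_Sp | apply/tv_fix/kw].
    by rewrite -{1}(tv_move nz) linvK //; apply: tv_Sp.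
have [[w]|alt] := classic (exists w, s (g w) w != 0); first exact: step.
have {}alt w : s (g w) w = 0.
  by apply/eqP/negPn/negP => nz; apply: alt; exists w.
have [-> | /eqP g1] := classic (g = lone); first exact: gen_one.
have [v gv] : exists v, g v - v != 0.
  apply: NNPP => no; case/eqP: g1; apply/lfunP => v; rewrite loneE.
  by apply/eqP; rewrite -subr_eq0; apply/negPn/negP => nz; apply: no; exists v.
have [w sw] := nondeg gv; set x := g v - v in gv sw *.
have xZ z : z \in Z -> s x z = 0.
  by move=> zZ; rewrite /x !sE -{1}(gZ z zZ) Sp_iso // subrr.
(* Alternation at [v + w] gives this; it makes the image of [w] under [tv x 1] times [g] pair with
   [w] to minus the square of [s x w]. *)
have xgw : s x (g w) = - s x w.
  have := alt (v + w); rewrite linearD /= !sE !alt add0r addr0 => /eqP; rewrite addr_eq0 => /eqP e.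
  by rewrite Sp_iso // (sC v (g w)) e; ring.
clearbody x.
rewrite (_ : g = lmul (tv x (- 1)) (lmul (tv x 1) g)); last first.
  by rewrite lmulA -tvD addNr tvx0 lmul1.
apply: TG_M; first exact: TG_tv.
apply: (step w).
- by apply: SpM => //; apply: tv_Sp.
- by move=> z zZ; rewrite lmulE gZ // tv_fix // xZ.
- by rewrite lmulE tvE !sE alt add0r mul1r xgw mulNr oppr_eq0 mulf_neq0.
Qed.

End Form.

(** * A presentation by transvections *)

(** The usual argument that a group is not the union of two proper subgroups: if neither witness
    serves both vectors, their sum does. *)
Lemma common_nbr (F : fieldType) (V : vectType F) (s : V -> V -> F) (Q : V -> Prop) u v :
  symplectic_form s -> (forall x y, Q x -> Q y -> Q (x + y)) ->
  (exists2 x, Q x & s x u != 0) -> (exists2 x, Q x & s x v != 0) ->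
  exists w, [/\ Q w, s w u != 0 & s w v != 0].
Proof.
move=> hs QD [x Qx xu] [y Qy yv].
have [xv|xv] := eqVneq (s x v) 0; last by exists x.
have [yu|yu] := eqVneq (s y u) 0; last by exists y.
exists (x + y); split; first exact: QD.
  by rewrite (sDl hs) yu addr0.
by rewrite (sDl hs) xv add0r.
Qed.

Section Presentation.
Variables (F : fieldType) (V : vectType F) (s : V -> V -> F).
Hypothesis hs : symplectic_form s.
Variables (P : abs_group) (act : P -> 'End(V)) (t : V -> F -> P) (e : V).
Hypotheses (act_Sp : forall p, Sp s (act p))
  (actM : forall p q, act (p ** q) = lmul (act p) (act q))
  (act_t : forall x a, act (t x a) = tv s x a)
  (tD : forall x a b, t x (a + b) = t x a ** t x b)
  (tZ : forall c x a, c != 0 -> t (c *: x) a = t x (c ^+ 2 * a))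
  (trel : forall u c v b, cj (t u c) (t v b) = t (tv s u c v) b)
  (common_perp : forall u v w, exists y, [/\ y != 0, s y u = 0, s y v = 0 & s y w = 0])
  (e0 : e != 0).
Implicit Types (p q r : P) (u v w x y z : V).

(** For [Q = perp v] this subgroup of [P] plays the role of the stabilizer of [v]. *)
Definition words (Q : V -> Prop) : P -> Prop :=
  gen_by (@ag_mul P) (ag_one P) (@ag_inv P) (fun p => exists x a, Q x /\ p = t x a).

Definition any_vec (v : V) := True.
Definition perp y : V -> Prop := fun x => s y x = 0.

Hypothesis free_e : forall p, words (perp e) p -> act p = lone -> p = ag_one P.

Let E := (sE hs).

Lemma words_t (Q : V -> Prop) x a : Q x -> words Q (t x a).
Proof. by move=> Qx; apply: gen_in; exists x, a. Qed.

Lemma act1 : act (ag_one P) = lone.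
Proof.
apply/lfunP => v; rewrite loneE; apply: (Sp_inj hs (act_Sp (ag_one P))).
by rewrite -lmulE -actM ag1.
Qed.

Lemma actVK p v : act p (act p^i v) = v.
Proof. by rewrite -lmulE -actM agV act1 loneE. Qed.

Lemma actKV p v : act p^i (act p v) = v.
Proof. by rewrite -lmulE -actM ag_mulV act1 loneE. Qed.

Lemma t0 x : t x 0 = ag_one P.
Proof. by apply: (@agI _ (t x 0)); rewrite -tD addr0 ag1. Qed.

Lemma tV x a : (t x a)^i = t x (- a).
Proof. by apply/esym/agVr; rewrite -tD subrr t0. Qed.

Lemma cj_t p v b : words any_vec p -> cj p (t v b) = t (act p v) b.
Proof.
move=> wp; elim: wp v b => [{}p [x [a [_ ->]]]||p1 p2 _ h1 _ h2|p1 _ h1] v b.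
- by rewrite trel act_t.
- by rewrite /cj !agN act1 loneE.
- by rewrite cjMl h2 h1 actM lmulE.
- by rewrite -{1}(actVK p1 v) -h1 cjK.
Qed.

Lemma words_cj p y q : words any_vec p -> words (perp y) q -> words (perp (act p y)) (cj p q).
Proof.
move=> wp; elim=> [{}q [x [a [yx ->]]]||q1 q2 _ h1 _ h2|q1 _ h1].
- by rewrite cj_t //; apply: words_t; rewrite /perp Sp_iso.
- by rewrite cj1; apply: gen_one.
- by rewrite cjM; apply: gen_mul.
- by rewrite cjV; apply: gen_inv.
Qed.

Lemma nbr u v : u != 0 -> v != 0 -> exists w, s w u != 0 /\ s w v != 0.
Proof.
have N x : x != 0 -> exists2 w, any_vec w & s w x != 0.
  by case/(nondeg hs) => w; rewrite (sC_neq0 hs); exists w.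
move=> /N hu /N hv; have [//|w [_ ? ?]] := common_nbr hs _ hu hv.
by exists w.
Qed.

Definition tr v w := t (w - v) (s w v)^-1.

Lemma tr_act v w : s w v != 0 -> act (tr v w) v = w.
Proof. by move=> nz; rewrite act_t tv_move. Qed.

Lemma trV v w : (tr v w)^i = tr w v.
Proof.
rewrite /tr tV -(opprB v w) -scaleN1r tZ ?oppr_eq0 ?oner_eq0 //.
by rewrite sqrrN expr1n mul1r (sC hs w v) invrN opprK.
Qed.

Lemma words_tr v w : words any_vec (tr v w). Proof. exact: words_t. Qed.

(** The hypothesis at [e] is transported to [y] by conjugating with the lift of a path of length two
    from [e] to [y]. *)
Lemma free y p : y != 0 -> words (perp y) p -> act p = lone -> p = ag_one P.
Proof.
move=> y0 wp p1; have [z [ze zy]] := nbr e0 y0.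
pose g := tr z y ** tr e z.
have wg : words any_vec g by apply: gen_mul; apply: words_tr.
have gy : act g e = y by rewrite actM lmulE !tr_act // (sC_neq0 hs).
clearbody g; have w' : words (perp e) (cj g^i p).
  have := words_cj (gen_inv wg) wp; congr (words (perp _) _).
  by rewrite -gy actKV.
rewrite -(cjVK g p) (free_e w') ?cj1 // /cj agVV !actM p1 lmulr1.
by rewrite -actM ag_mulV act1.
Qed.

(** Equality of left cosets of [words (perp v)]. Lifts of two paths from [v] with the same end
    should agree in this sense, which is simple connectedness. *)
Definition eqv v p q := exists r, words (perp v) r /\ p = q ** r.

Lemma eqv_refl v p : eqv v p p.
Proof. by exists (ag_one P); split; [apply: gen_one | rewrite ag1]. Qed.

Lemma eqv_sym v p q : eqv v p q -> eqv v q p.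
Proof. by case=> r [wr ->]; exists r^i; split; [apply: gen_inv | rewrite !agN]. Qed.

Lemma eqv_trans v q p r : eqv v p q -> eqv v q r -> eqv v p r.
Proof.
case=> a [wa ->] [b [wb ->]]; exists (b ** a); split; [exact: gen_mul | by rewrite !agN].
Qed.

Lemma eqv_mull v r p q : eqv v p q -> eqv v (r ** p) (r ** q).
Proof. by case=> a [wa ->]; exists a; rewrite !agN. Qed.

Lemma eqv_mulr v r p q : words any_vec r -> eqv (act r v) p q -> eqv v (p ** r) (q ** r).
Proof.
move=> wr [a [wa ->]]; exists (cj r^i a); split.
  by have := words_cj (gen_inv wr) wa; rewrite actKV.
by rewrite /cj !agN.
Qed.

(* With [a = s v0 v1], [b = s v1 v2], [c = s v2 v0], the loop through [v0, v1, v2] is a single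
   transvection fixing [v0]; this identity lifts because all four vectors lie in some [y^perp]. *)
Lemma triangle v0 v1 v2 : s v0 v1 != 0 -> s v1 v2 != 0 -> s v2 v0 != 0 ->
  eqv v0 (tr v1 v2 ** tr v0 v1) (tr v0 v2).
Proof.
move=> a0 b0 c0; set u := s v2 v0 *: (v0 - v1) + s v0 v1 *: (v0 - v2).
pose r := t u (s v0 v1 * s v1 v2 * s v2 v0)^-1.
exists r; split.
  by apply: words_t; rewrite /perp /u !E (sC hs v0 v2); ring.
have [y [y0 y_0 y_1 y_2]] := common_perp v0 v1 v2.
suff h : (tr v0 v2 ** r)^i ** (tr v1 v2 ** tr v0 v1) = ag_one P.
  by rewrite -[RHS]ag1 -h agKV.
apply: (free y0).
  apply: gen_mul; [apply/gen_inv/gen_mul | apply: gen_mul]; apply: words_t;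
  by rewrite /perp /u !E ?y_0 ?y_1 ?y_2; ring.
have -> : lone = act ((tr v0 v2 ** r)^i ** (tr v0 v2 ** r)) by rewrite ag_mulV act1.
rewrite !actM; congr lmul; apply/lfunP => x; rewrite !lmulE !act_t.
apply: (s_inj hs) => w; rewrite !(tvE hs) /u !E.
rewrite (sC hs v1 v0) (sC hs v2 v1) (sC hs v0 v2).
by field; rewrite !oppr_eq0 a0 b0 c0.
Qed.

(** A quadrangle with a diagonal edge is cut into two triangles. With no diagonal edge, [v0 + v1] is
    adjacent to all four vertices and can be inserted as a centre. *)
Lemma quad v0 v1 v2 v3 : s v0 v1 != 0 -> s v1 v2 != 0 -> s v0 v3 != 0 -> s v3 v2 != 0 ->
  eqv v0 (tr v1 v2 ** tr v0 v1) (tr v3 v2 ** tr v0 v3).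
Proof.
move=> h01 h12 h03 h32.
have half x y : s v0 x != 0 -> s x v2 != 0 -> s v0 y != 0 -> s y v2 != 0 -> s x y != 0 ->
    eqv v0 (tr x v2 ** tr v0 x) (tr y v2 ** tr v0 y).
  move=> h0x hx2 h0y hy2 hxy; apply: (@eqv_trans _ (tr y v2 ** (tr x y ** tr v0 x))).
    rewrite ag_mulA; apply: eqv_mulr; first exact: words_tr.
    rewrite tr_act 1?(sC_neq0 hs) //; apply/eqv_sym/triangle => //; by rewrite (sC_neq0 hs).
  by apply/eqv_mull/triangle => //; rewrite (sC_neq0 hs).
have [h02|h02] := eqVneq (s v0 v2) 0; last first.
  apply: (@eqv_trans _ (tr v0 v2)); last apply: eqv_sym; apply: triangle => //;
  by rewrite (sC_neq0 hs).
have [h13|h13] := eqVneq (s v1 v3) 0; last exact: half.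
have [z0 z1 z2 z3] : [/\ s v0 (v0 + v1) != 0, s v1 (v0 + v1) != 0, s (v0 + v1) v2 != 0 & s (v0 + v1) v3 != 0].
  by rewrite !E add0r !addr0 h02 h13 add0r addr0 (sC_neq0 hs v1).
apply: (eqv_trans (half v1 (v0 + v1) _ _ _ _ _)) => //.
by apply: half.
Qed.

(** Lifts of paths of length two from [e] to [v]. By [quad] they form a section over the nonzero
    vectors, well defined up to [eqv e]. *)
Definition sec v q := exists w, [/\ s w e != 0, s w v != 0 & q = tr w v ** tr e w].

Lemma sec_ex v : v != 0 -> exists q, sec v q.
Proof. by move=> v0; have [w [we wv]] := nbr e0 v0; exists (tr w v ** tr e w), w. Qed.

Lemma sec_words v q : sec v q -> words any_vec q.
Proof. by case=> w [_ _ ->]; apply: gen_mul; apply: words_tr. Qed.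

Lemma sec_act v q : sec v q -> act q e = v.
Proof. by case=> w [? ? ->]; rewrite actM lmulE !tr_act // (sC_neq0 hs). Qed.

Lemma sec_eqv v q q' : sec v q -> sec v q' -> eqv e q q'.
Proof. by case=> w [we wv ->] [w' [we' wv' ->]]; apply: quad => //; rewrite (sC_neq0 hs). Qed.

Lemma sec_near v q : s e v != 0 -> sec v q -> eqv e q (tr e v).
Proof. by move=> ev [w [we wv ->]]; apply: triangle; rewrite // (sC_neq0 hs). Qed.

Lemma sec_edge v v' q : s v' v != 0 -> sec v q -> exists q', sec v' q' /\ eqv e (tr v v' ** q) q'.
Proof.
move=> vv' sq.
(* A common neighbour [z] of [e], [v] and [v'] lets both paths run through [z], leaving only the
   triangle [z], [v], [v']. *)
have via z : s z e != 0 -> s z v != 0 -> s z v' != 0 ->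
    exists q', sec v' q' /\ eqv e (tr v v' ** q) q'.
  move=> ze zv zv'; exists (tr z v' ** tr e z); split; first by exists z.
  have /(eqv_mull (tr v v')) : eqv e q (tr z v ** tr e z) by apply: sec_eqv sq _; exists z.
  move/eqv_trans; apply; rewrite ag_mulA; apply: eqv_mulr; first exact: words_tr.
  by rewrite tr_act //; apply: triangle; rewrite // (sC_neq0 hs).
have [ev|ev] := eqVneq (s e v) 0; have [ev'|ev'] := eqVneq (s e v') 0.
- have [w we] := nondeg hs e0; rewrite (sC_neq0 hs) in we.
  have v'v : s v v' != 0 by rewrite (sC_neq0 hs).
  (* The coefficients make the pairings with [v] and [v'] both equal to 1; since [e] is orthogonal
     to both, the pairing with [e] stays that of [w]. *)
  apply: (via (w + ((1 - s w v') / s v v') *: v + ((1 - s w v) / s v' v) *: v')).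
  + by rewrite !E (sC0 hs ev) (sC0 hs ev') !mulr0 !addr0.
  + rewrite !E mulr0 addr0 divfK // addrC subrK; exact: oner_neq0.
  + rewrite !E mulr0 addr0 divfK // addrC subrK; exact: oner_neq0.
- apply: (via (e + v')); rewrite !E ?add0r ?addr0 ?ev ?add0r //; by rewrite (sC_neq0 hs).
- apply: (via (e + v)); rewrite !E ?add0r ?addr0 ?ev' ?add0r //; by rewrite (sC_neq0 hs).
- have v'0 : v' != 0 by apply: contra vv' => /eqP->; rewrite !E.
  have [q' sq'] := sec_ex v'0; exists q'; split=> //.
  apply: eqv_trans (eqv_mull _ (sec_near ev sq)) _.
  apply: (@eqv_trans _ (tr e v')); last exact/eqv_sym/sec_near.
  by apply: triangle; rewrite // (sC_neq0 hs).
Qed.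

(** Equivariance of the section. A generator either fixes [v], and is then absorbed by the coset, or
    is the edge transvection from [v] to its image, which is [sec_edge]. *)
Lemma sec_step p v q : words any_vec p -> v != 0 -> sec v q ->
  exists q', sec (act p v) q' /\ eqv e (p ** q) q'.
Proof.
move=> wp; elim: wp v q => [{}p [x [a [_ ->]]]||p1 p2 _ h1 _ h2|p1 _ h1] v q v0 sq.
- rewrite act_t; have [xv|xv] := eqVneq (s x v) 0.
    rewrite tv_fix //; exists q; split=> //; exists (cj q^i (t x a)); split; last by rewrite /cj !agN.
    have := @words_cj q^i v (t x a) (gen_inv (sec_words sq)).
    by rewrite -{2}(sec_act sq) actKV; apply; apply/words_t/(sC0 hs).
  have [->|a0] := eqVneq a 0.
    by rewrite tvx0 // loneE t0; exists q; split=> //; rewrite ag_mul1; apply: eqv_refl.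
  have nz : s (tv s x a v) v != 0 by rewrite (tvE hs) !E add0r !mulf_neq0.
  have -> : t x a = tr v (tv s x a v).
    rewrite /tr (tvE hs) addrAC subrr add0r tZ ?mulf_neq0 // !E add0r; congr t.
    by field; rewrite a0 xv.
  exact: sec_edge.
- by exists q; rewrite act1 loneE ag_mul1; split=> //; apply: eqv_refl.
- have [q2 [s2 e2]] := h2 _ _ v0 sq.
  have [q1 [s1 e1]] := h1 _ _ (Sp_neq0 hs (act_Sp p2) v0) s2.
  exists q1; rewrite actM lmulE; split=> //.
  by rewrite agA; apply: eqv_trans (eqv_mull _ e2) e1.
- have v'0 := Sp_neq0 hs (act_Sp p1^i) v0.
  have [q' sq'] := sec_ex v'0; exists q'; split=> //.
  have [q1 [s1 e1]] := h1 _ _ v'0 sq'; rewrite actVK in s1.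
  rewrite -(agVK p1 q'); apply: eqv_mull.
  by apply: eqv_trans (sec_eqv sq s1) _; apply: eqv_sym.
Qed.

(** By equivariance a word acting trivially preserves the coset over [e], so it lies in
    [words (perp e)], where [free_e] decides. *)
Lemma transvection_presentation p : words any_vec p -> act p = lone -> p = ag_one P.
Proof.
move=> wp p1; have [w [we _]] := nbr e0 e0.
have s1 : sec e (ag_one P) by exists w; split=> //; rewrite -(trV w e) agV.
have [q [sq [r [wr er]]]] := sec_step wp e0 s1; rewrite p1 loneE in sq.
have [r' [wr' er']] := sec_eqv sq s1; apply: free_e => //.
by rewrite ag1 in er; rewrite er er' ag_mul1; apply: gen_mul.
Qed.

End Presentation.

(** * Gluing along a hyperbolic plane and its complement *)

Section Transitivity.
Variables (F : fieldType) (V : vectType F) (s : V -> V -> F).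
Hypothesis hs : symplectic_form s.
Variable Q : V -> Prop.
Hypotheses (QD : forall x y, Q x -> Q y -> Q (x + y)) (QB : forall x y, Q x -> Q y -> Q (x - y)).
Let E := (sE hs).

Lemma TG_trans u v : Q u -> Q v ->
  (exists2 x, Q x & s x u != 0) -> (exists2 x, Q x & s x v != 0) ->
  exists g, TG s Q g /\ g u = v.
Proof.
move=> Qu Qv hu hv; have [w [Qw wu wv]] := common_nbr hs QD hu hv.
exists (lmul (tv s (v - w) (s v w)^-1) (tv s (w - u) (s w u)^-1)); split.
  by apply: TG_M; apply: TG_tv; apply: QB.
by rewrite lmulE !tv_move // (sC_neq0 hs).
Qed.

(** Since [v' - v] is orthogonal to [u], the edge transvection from [v] to [v'] fixes [u]. When [v]
    and [v'] are orthogonal, the detour through [v + u] works. *)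
Lemma TG_trans_pair u v v' : Q u -> Q v -> Q v' -> s u v != 0 -> s u v = s u v' ->
  exists g, [/\ TG s Q g, g u = u & g v = v'].
Proof.
move=> Qu Qv Qv' uv e; have [v'v|v'v] := eqVneq (s v' v) 0; last first.
  exists (tv s (v' - v) (s v' v)^-1); split; first by apply/TG_tv/QB.
    by rewrite tv_fix // !E (sC hs v) (sC hs v') e subrr.
  exact: tv_move.
have zv : s (v + u) v != 0 by rewrite !E add0r.
have v'z : s v' (v + u) != 0 by rewrite !E v'v add0r (sC_neq0 hs) -e.
exists (lmul (tv s (v' - (v + u)) (s v' (v + u))^-1) (tv s ((v + u) - v) (s (v + u) v)^-1)).
split.
- by apply: TG_M; apply: TG_tv; apply: QB => //; apply: QD.
- by rewrite lmulE !tv_fix // !E ?(sC hs v) ?(sC hs v') -?e; ring.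
- by rewrite lmulE !tv_move.
Qed.

End Transitivity.

Lemma Sp_TG (F : fieldType) (V : vectType F) (s : V -> V -> F) (g : 'End(V)) :
  symplectic_form s -> Sp s g -> TG s (@any_vec F V) g.
Proof.
move=> hs Sg; apply: (TG_mono (Q := fun x => forall z, z \in 0%VS -> s x z = 0)) => //.
by apply: Sp_generated => // z; rewrite memv0 => /eqP->; rewrite linear0.
Qed.

Section Dual.
Variables (F : fieldType) (V : vectType F) (s : V -> V -> F).
Hypothesis hs : symplectic_form s.

Lemma dual_pair u v p q : u != 0 -> (forall m, v <> m *: u) -> exists x, s x u = p /\ s x v = q.
Proof.
move=> u0 uv; have [a ua] := nondeg hs u0; rewrite (sC_neq0 hs) in ua.
have [b bu bv] : exists2 b, s b u = 0 & s b v != 0.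
  have [b0 h] : exists w, s (v - (s a v / s a u) *: u) w != 0.
    by apply: (nondeg hs); rewrite subr_eq0; apply/eqP/uv.
  exists (b0 - (s b0 u / s a u) *: a); first by rewrite !(sE hs) divfK // subrr.
  apply: contra h => /eqP h; rewrite -oppr_eq0 -[X in _ == X]h; apply/eqP.
  by rewrite !(sE hs) (sC hs v) (sC hs u); ring.
exists ((p / s a u) *: a + ((q - p / s a u * s a v) / s b v) *: b).
by rewrite !(sE hs) bu; split; field; rewrite ?ua ?bv.
Qed.
End Dual.

Section ProductGroup.
Variables (F : fieldType) (V : vectType F) (s : V -> V -> F).
Hypothesis hs : symplectic_form s.
Variable H : abs_group.

(** The product of Sp(V) and [H], in which the graph of the wanted homomorphism will be generated.
    The group laws hold only for invertible first components, hence the sigma type. *)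
Definition isolift := {p : 'End(V) * H | Sp s p.1}.

Lemma lift_eq (p q : isolift) : sval p = sval q -> p = q.
Proof. by case: p q => [p sp] [q sq] /= e; subst q; congr exist; apply: proof_irrelevance. Qed.

Definition liftM (p q : isolift) : isolift :=
  exist _ (lmul (sval p).1 (sval q).1, (sval p).2 ** (sval q).2) (SpM hs (svalP p) (svalP q)).
Definition lift1 : isolift := exist _ (lone, ag_one H) (Sp1 hs).
Definition liftV (p : isolift) : isolift := exist _ (linv (sval p).1, (sval p).2^i) (SpV hs (svalP p)).

Lemma liftA p q r : liftM p (liftM q r) = liftM (liftM p q) r.
Proof. by apply: lift_eq; rewrite /= lmulA ag_mulA. Qed.
Lemma lift1M p : liftM lift1 p = p.
Proof. by apply: lift_eq; case: p => -[g h] /= ?; rewrite lmul1 ag_mul1. Qed.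
Lemma liftVM p : liftM (liftV p) p = lift1.
Proof. by apply: lift_eq; case: p => -[g h] /= ?; rewrite (lmulV hs) // ag_mulV. Qed.

Definition liftG : abs_group := AbsGroup liftA lift1M liftVM.
End ProductGroup.

Fact block_key : unit. Proof. exact: tt. Qed.

Section TwoBlocks.
Variables (F : fieldType) (V : vectType F) (s : V -> V -> F).
Hypothesis hs : symplectic_form s.
Variables (e f : V).
Hypothesis ef : s e f = 1.
Let E := (sE hs).
Implicit Types (u v w x y : V) (a b c m : F) (g k : 'End(V)).

(* Locked, so that rewriting with the bilinearity of [s] does not unfold the projections. *)
Definition pA v := locked_with block_key (s v f *: e + s e v *: f).
Definition pW v := locked_with block_key (v - pA v).
Lemma pAE v : pA v = s v f *: e + s e v *: f. Proof. by rewrite /pA unlock. Qed.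
Lemma pWE v : pW v = v - pA v. Proof. by rewrite /pW unlock. Qed.
Definition inW w := s e w = 0 /\ s f w = 0.
(** The plane is described as the orthogonal complement of W, so that its stability under [KA] is
    immediate. *)
Definition inA x := forall w, inW w -> s x w = 0.
Definition KA g := Sp s g /\ forall w, inW w -> g w = w.
Definition KW g := [/\ Sp s g, g e = e & g f = f].
Definition G1 g := Sp s g /\ g e = e.

Lemma fe : s f e = - 1. Proof. by rewrite (sC hs) ef. Qed.

Lemma pAW v : pA v + pW v = v. Proof. by rewrite pWE addrC subrK. Qed.

Lemma pW_in v : inW (pW v).
Proof. by rewrite /inW pWE pAE !E ef fe (sC hs v); split; ring. Qed.

Lemma pA_in v : inA (pA v).
Proof. by move=> w [ew fw]; rewrite pAE !E ew fw !mulr0 addr0. Qed.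

Lemma inAD x y : inA x -> inA y -> inA (x + y).
Proof. by move=> hx hy w hw; rewrite E hx ?hy ?addr0. Qed.
Lemma inAZ c x : inA x -> inA (c *: x).
Proof. by move=> hx w hw; rewrite E hx ?mulr0. Qed.
Lemma inAB x y : inA x -> inA y -> inA (x - y).
Proof. by move=> hx hy; rewrite -scaleN1r; apply/inAD/inAZ. Qed.
Lemma inWD x y : inW x -> inW y -> inW (x + y).
Proof. by move=> [ex fx] [ey fy]; rewrite /inW !E ex ey fx fy addr0. Qed.
Lemma inWZ c x : inW x -> inW (c *: x).
Proof. by move=> [ex fx]; rewrite /inW !E ex fx mulr0. Qed.
Lemma inWB x y : inW x -> inW y -> inW (x - y).
Proof. by move=> hx hy; rewrite -scaleN1r; apply/inWD/inWZ. Qed.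

Lemma e_in : inA e. Proof. by move=> w []. Qed.
Lemma f_in : inA f. Proof. by move=> w []. Qed.

Lemma inAW x w : inA x -> inW w -> s w x = 0.
Proof. by move=> hx hw; apply/(sC0 hs)/hx. Qed.

Lemma pA_W w : inW w -> pA w = 0.
Proof. by move=> [ew fw]; rewrite pAE ew (sC hs) fw oppr0 !scale0r addr0. Qed.

Lemma pAD u v : pA (u + v) = pA u + pA v.
Proof. by rewrite !pAE !E !scalerDl addrACA. Qed.

Lemma pWD u v : pW (u + v) = pW u + pW v.
Proof. by rewrite !pWE pAD opprD addrACA. Qed.

Lemma pAZ c v : pA (c *: v) = c *: pA v.
Proof. by rewrite !pAE !E scalerDr !scalerA. Qed.

Lemma pWZ c v : pW (c *: v) = c *: pW v.
Proof. by rewrite !pWE pAZ scalerBr. Qed.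

Lemma pW_W w : inW w -> pW w = w.
Proof. by move=> /pA_W h; rewrite pWE h subr0. Qed.

Lemma pW_A x : inA x -> pW x = 0.
Proof.
move=> hx; apply: (s_inj hs) => z; rewrite -(pAW z) !E pA_in ?add0r; last exact: pW_in.
by rewrite (pWE x) !E !(@inAW _ (pW z)) ?subrr //; [exact: pA_in|exact: pW_in|exact: pW_in].
Qed.

Lemma pA_A x : inA x -> pA x = x.
Proof. by move=> /pW_A h; rewrite -{2}(pAW x) h addr0. Qed.

Lemma pA_AW x w : inA x -> inW w -> pA (x + w) = x.
Proof. by move=> hx hw; rewrite pAD pA_A // pA_W // addr0. Qed.

Lemma pW_AW x w : inA x -> inW w -> pW (x + w) = w.
Proof. by move=> hx hw; rewrite pWD pW_A // pW_W // add0r. Qed.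

Lemma s_split u v : s u v = s (pA u) (pA v) + s (pW u) (pW v).
Proof.
rewrite -{1}(pAW u) -{1}(pAW v) !E (inAW (pA_in v) (pW_in u)) (pA_in u (pW_in v)).
by rewrite addr0 add0r.
Qed.

Lemma KA_group : group_pred KA.
Proof.
have [S1 SM SV] := Sp_group hs.
split; first by split=> // w _; rewrite loneE.
  by move=> g k [Sg hg] [Sk hk]; split; [exact: SM | move=> w hw; rewrite lmulE hk ?hg].
by move=> g [Sg hg]; split; [exact: SV | move=> w hw; exact (linv_fix hs Sg (hg w hw))].
Qed.

Lemma KW_group : group_pred KW.
Proof.
have [S1 SM SV] := Sp_group hs.
split; first by split=> //; rewrite loneE.
  by move=> g k [Sg ge gf] [Sk ke kf]; split; rewrite ?lmulE ?ke ?kf //; exact: SM.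
by move=> g [Sg ge gf]; split; [exact: SV | exact (linv_fix hs Sg ge) | exact (linv_fix hs Sg gf)].
Qed.

Lemma G1_group : group_pred G1.
Proof.
have [S1 SM SV] := Sp_group hs.
split; first by split=> //; rewrite loneE.
  by move=> g k [Sg ge] [Sk ke]; split; rewrite ?lmulE ?ke //; exact: SM.
by move=> g [Sg ge]; split; [exact: SV | exact (linv_fix hs Sg ge)].
Qed.

Lemma KW_G1 g : KW g -> G1 g. Proof. by case. Qed.

Lemma tv_KA x a : inA x -> KA (tv s x a).
Proof. by move=> hx; split=> [|w hw]; [exact: tv_Sp | rewrite tv_fix ?hx]. Qed.

Lemma tv_KW w a : inW w -> KW (tv s w a).
Proof. by case=> ew fw; split; [exact: tv_Sp | |]; apply/tv_fix/(sC0 hs). Qed.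

Lemma tv_G1 x a : s e x = 0 -> G1 (tv s x a).
Proof. by move=> ex; split; [exact: tv_Sp | apply/tv_fix/(sC0 hs)]. Qed.

Lemma KA_in g x : KA g -> inA x -> inA (g x).
Proof. by move=> [Sg hg] hx w hw; rewrite -(hg w hw) (Sp_iso _ _ Sg) hx. Qed.

Lemma KW_in g w : KW g -> inW w -> inW (g w).
Proof. by move=> [Sg ge gf] [ew fw]; split; [rewrite -ge | rewrite -gf]; rewrite (Sp_iso _ _ Sg). Qed.

Lemma KW_A g x : KW g -> inA x -> g x = x.
Proof. by move=> [Sg ge gf] /pA_A <-; rewrite pAE linearD !linearZ /= ge gf. Qed.

Lemma KA_act g v : KA g -> g v = g (pA v) + pW v.
Proof. by move=> [Sg hg]; rewrite -{1}(pAW v) linearD /= (hg (pW v)) //; apply: pW_in. Qed.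

Lemma pA_KA g v : KA g -> pA (g v) = g (pA v).
Proof.
by move=> Kg; rewrite (KA_act _ Kg) pA_AW //; [apply: KA_in (pA_in _) | apply: pW_in].
Qed.

Lemma pW_KA g v : KA g -> pW (g v) = pW v.
Proof.
by move=> Kg; rewrite (KA_act _ Kg) pW_AW //; [apply: KA_in (pA_in _) | apply: pW_in].
Qed.

Lemma KW_act g v : KW g -> g v = pA v + g (pW v).
Proof. by move=> Kg; rewrite -{1}(pAW v) linearD /= (KW_A Kg) //; apply: pA_in. Qed.

Lemma pA_KW g v : KW g -> pA (g v) = pA v.
Proof.
by move=> Kg; rewrite (KW_act _ Kg) pA_AW //; [apply: pA_in | apply: KW_in (pW_in _)].
Qed.

Lemma pW_KW g v : KW g -> pW (g v) = g (pW v).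
Proof.
by move=> Kg; rewrite (KW_act _ Kg) pW_AW //; [apply: pA_in | apply: KW_in (pW_in _)].
Qed.

Lemma KA_KW_commute g k : KA g -> KW k -> lmul g k = lmul k g.
Proof.
move=> Kg Kk; apply/lfunP => v; rewrite !lmulE (KW_act (g v) Kk) (KA_act (k v) Kg).
by rewrite (pA_KA v Kg) (pW_KA v Kg) (pA_KW v Kk) (pW_KW v Kk).
Qed.

Lemma TG_KA g : TG s inA g -> KA g.
Proof. by apply: TG_ind; [exact: KA_group | move=> *; apply: tv_KA]. Qed.

Lemma TG_KW g : TG s inW g -> KW g.
Proof. by apply: TG_ind; [exact: KW_group | move=> *; apply: tv_KW]. Qed.

Lemma KA_TG g : KA g -> TG s inA g.
Proof.
move=> [Sg hg]; have inWP w : w \in lker (linfun pA) -> inW w.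
  rewrite memv_ker linear_lfun => [/eqP h|c u v]; last by rewrite pAD pAZ.
  by rewrite -(pAW w) h add0r; apply: pW_in.
apply: (TG_mono (Q := fun x => forall z, z \in lker (linfun pA) -> s x z = 0)).
  move=> x hx w hw; apply: hx; rewrite memv_ker linear_lfun ?pA_W // => c u v.
  by rewrite pAD pAZ.
by apply: Sp_generated => // z /inWP; apply: hg.
Qed.

Lemma perp_TG y g : Sp s g -> g y = y -> TG s (fun x => s y x = 0) g.
Proof.
move=> Sg gy; apply: (TG_mono (Q := fun x => forall z, z \in <[y]>%VS -> s x z = 0)).
  by move=> x hx; apply/(sC0 hs)/hx/memv_line.
by apply: Sp_generated => // z /vlineP[c ->]; rewrite linearZ /= gy.
Qed.

Lemma nbr_A x : inA x -> x != 0 -> exists2 z, inA z & s z x != 0.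
Proof.
move=> hx x0; have [z xz] := nondeg hs x0; exists (pA z); first exact: pA_in.
by rewrite (sC_neq0 hs); move: xz; rewrite s_split pW_A // E addr0 pA_A.
Qed.

Lemma nbr_W x : inW x -> x != 0 -> exists2 z, inW z & s z x != 0.
Proof.
move=> hx x0; have [z xz] := nondeg hs x0; exists (pW z); first exact: pW_in.
by rewrite (sC_neq0 hs); move: xz; rewrite s_split pA_W // E add0r pW_W.
Qed.

Lemma e_neq0 : e != 0.
Proof. by apply: contra (oner_neq0 F) => /eqP e0; rewrite -ef e0 E. Qed.

Lemma KA_trans x : inA x -> x != 0 -> exists g, KA g /\ g e = x.
Proof.
move=> hx x0; have [] := @TG_trans _ _ _ hs inA _ _ e x e_in hx; try by move=> *; auto using inAD, inAB.
- exact: (nbr_A e_in e_neq0).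
- exact: nbr_A.
by move=> g [/TG_KA Kg ge]; exists g.
Qed.

Lemma KW_trans u v : inW u -> inW v -> u != 0 -> v != 0 -> exists g, KW g /\ g u = v.
Proof.
move=> hu hv u0 v0; have [] := @TG_trans _ _ _ hs inW _ _ u v hu hv; try by move=> *; auto using inWD, inWB.
- exact: nbr_W.
- exact: nbr_W.
by move=> g [/TG_KW Kg gu]; exists g.
Qed.

(** * Images of transvections from homomorphisms on Sp(A) and on the stabilizer of [e] *)

Variables (H : abs_group) (fA f1 : 'End(V) -> H).
Hypotheses (homA : hom_on KA fA) (homG1 : hom_on G1 f1)
  (comm : forall g k, KA g -> KW k -> fA g ** f1 k = f1 k ** fA g)
  (agree_e : forall a, fA (tv s e a) = f1 (tv s e a))
  (torus : forall h m w a, KA h -> h e = m *: e -> inW w ->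
     cj (fA h) (f1 (tv s (e + w) a)) = f1 (tv s (m *: e + w) a)).

Definition toA x : 'End(V) := epsilon (inhabits lone) (fun g => KA g /\ g e = x).

Lemma toAP x : inA x -> x != 0 -> KA (toA x) /\ toA x e = x.
Proof. by move=> hx x0; exact: (epsilon_spec (inhabits lone) (fun g => KA g /\ g e = x) (KA_trans hx x0)). Qed.

(* The image in [H] of the transvection [tv s v a]. *)
Definition tau v a : H :=
  if pA v == 0 then f1 (tv s v a) else cj (fA (toA (pA v))) (f1 (tv s (e + pW v) a)).

Lemma homA_J k g : KA k -> KA g -> fA (lmul (lmul k g) (linv k)) = cj (fA k) (fA g).
Proof. exact: (homJ hs (fun g h => proj1 h) KA_group homA). Qed.

Lemma homG1_J k g : G1 k -> G1 g -> f1 (lmul (lmul k g) (linv k)) = cj (f1 k) (f1 g).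
Proof. exact: (homJ hs (fun g h => proj1 h) G1_group homG1). Qed.

Lemma pA0_inW v : pA v = 0 -> inW v.
Proof. by move=> h; rewrite -(pAW v) h add0r; apply: pW_in. Qed.

Lemma G1_eW w a : inW w -> G1 (tv s (e + w) a).
Proof. by move=> [ew _]; apply: tv_G1; rewrite !E ew addr0. Qed.

(** The elements chosen for [v] and [g v] match up to some [k] in [KA] fixing [e], and [torus] with
    [m = 1] shows that [k] has no effect. So the choice made by [toA] is immaterial. *)
Lemma tau_KA g v a : KA g -> tau (g v) a = cj (fA g) (tau v a).
Proof.
move=> Kg; have Sg : Sp s g by case: Kg.
rewrite /tau pA_KA // pW_KA //; have [p0|p0] := eqVneq (pA v) 0.
  rewrite p0 linear0 eqxx; have hv := pA0_inW p0.
  case: (Kg) => _ -> //; rewrite (cj_commute (comm Kg (tv_KW a hv))) //.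
have gp0 := Sp_neq0 hs Sg p0; rewrite (negbTE gp0).
have [K0 e0] := toAP (pA_in v) p0; have [K1 e1] := toAP (KA_in Kg (pA_in v)) gp0.
move: (toA (g (pA v))) (toA (pA v)) K0 e0 K1 e1 => g1 g0 K0 e0 K1 e1.
have [_ KM KV] := KA_group.
have [S0 S1] : Sp s g0 /\ Sp s g1 by split; [case: K0 | case: K1].
pose k := lmul (linv g1) (lmul g g0).
have Kk : KA k by apply: (KM); [exact: KV | exact: KM].
have ke : k e = 1 *: e by rewrite scale1r !lmulE e0 -e1 (linvK hs).
have -> : fA g1 = fA g ** fA g0 ** (fA k)^i.
  have -> : fA g ** fA g0 = fA g1 ** fA k; last by rewrite !agN.
  by rewrite -!homA ?lmulA ?(lmulVr hs) ?lmul1 //; apply: KM.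
rewrite !cjMl; congr (cj _ (cj _ _)).
by rewrite -{1}[e]scale1r -(torus _ Kk ke (pW_in v)) cjK.
Qed.

Lemma tau_KW k v a : KW k -> tau (k v) a = cj (f1 k) (tau v a).
Proof.
move=> Kk; have Sk : Sp s k by case: Kk.
rewrite /tau pA_KW // pW_KW //; have [p0|p0] := eqVneq (pA v) 0.
  by rewrite -homG1_J ?tvJ //; [apply: KW_G1 | apply/KW_G1/tv_KW/pA0_inW].
have [K0 _] := toAP (pA_in v) p0.
rewrite -cjMl -(comm K0 Kk) cjMl -homG1_J ?tvJ //; last exact/G1_eW/pW_in.
  by rewrite linearD /=; case: Kk => _ ->.
exact: KW_G1.
Qed.

(** The A-component of [v] is then a multiple of [e], which is the situation that [torus]
    describes. *)
Lemma tau_perp v a : s e v = 0 -> tau v a = f1 (tv s v a).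
Proof.
move=> ev; rewrite /tau; case: eqVneq => // p0.
have [K0 e0] := toAP (pA_in v) p0.
have pe : pA v = s v f *: e by rewrite pAE ev scale0r addr0.
by rewrite (@torus _ (s v f) _ a K0 _ (pW_in v)) ?e0 // -pe pAW.
Qed.

Lemma hom1_A : fA lone = ag_one H. Proof. exact: hom1 KA_group homA. Qed.
Lemma hom1_G1 : f1 lone = ag_one H. Proof. exact: hom1 G1_group homG1. Qed.

Lemma tau_inA v a : inA v -> tau v a = fA (tv s v a).
Proof.
move=> hv; have [->|v0] := eqVneq v 0; first by rewrite tau_perp ?E // !(tv0 hs) hom1_A hom1_G1.
have [g [Kg <-]] := KA_trans hv v0.
rewrite tau_KA // tau_perp ?E // -agree_e -homA_J ?tvJ //; first by case: Kg.
exact/tv_KA/e_in.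
Qed.

(** Reduces identities about a single [tau v] to vectors orthogonal to [e], where [f1] is a
    homomorphism. *)
Lemma tau_ind v : exists G w, (forall a, tau v a = cj G (f1 (tv s w a))) /\ s e w = 0 /\
  exists2 g : 'End(V), v = g w & forall u a, tau (g u) a = cj G (tau u a).
Proof.
have [p0|p0] := eqVneq (pA v) 0.
  have [ev _] := pA0_inW p0; exists (ag_one H), v; split=> [a|]; first by rewrite tau_perp // /cj !agN.
  by split=> //; exists lone => [|u a]; rewrite loneE // /cj !agN.
have [Kg ge] := toAP (pA_in v) p0; exists (fA (toA (pA v))), (e + pW v); split=> [a|].
  by rewrite /tau (negbTE p0).
split; first by rewrite !E; case: (pW_in v) => -> _; rewrite addr0.
exists (toA (pA v)) => [|u a]; last exact: tau_KA.
by rewrite linearD /= ge; case: Kg => _ -> //; rewrite ?pAW //; apply: pW_in.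
Qed.

Lemma tauD v a b : tau v (a + b) = tau v a ** tau v b.
Proof.
have [G [w [h [ew _]]]] := tau_ind v.
by rewrite !h tvD // homG1 ?cjM //; apply: tv_G1.
Qed.

Lemma tauZ c v a : tau (c *: v) a = tau v (c ^+ 2 * a).
Proof.
have [G [w [_ [ew [g -> hg]]]]] := tau_ind v.
have -> : c *: g w = g (c *: w) by rewrite linearZ.
by rewrite !hg !tau_perp ?(tvZ hs) // E ew mulr0.
Qed.

Definition tau_rel u v := forall c b, cj (tau u c) (tau v b) = tau (tv s u c v) b.

Lemma rel_equiv g G u v : Sp s g -> (forall x a, tau (g x) a = cj G (tau x a)) ->
  tau_rel (g u) (g v) -> tau_rel u v.
Proof.
move=> Sg hG r c b; have := r c b; rewrite -lmulE -tvJ' // lmulE !hG => h.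
rewrite -[RHS](cjK G) -h -[LHS](cjK G); congr cj.
by rewrite /cj !agN.
Qed.

Lemma rel_KA g u v : KA g -> tau_rel (g u) (g v) -> tau_rel u v.
Proof. by move=> Kg; apply: rel_equiv (fun x a => tau_KA x a Kg); case: Kg. Qed.

Lemma rel_KW g u v : KW g -> tau_rel (g u) (g v) -> tau_rel u v.
Proof. by move=> Kg; apply: rel_equiv (fun x a => tau_KW x a Kg); case: Kg. Qed.

Lemma rel_inA u v : inA u -> tau_rel u v.
Proof. by move=> hu c b; rewrite (tau_inA c hu) -tau_KA //; apply: tv_KA. Qed.

Lemma rel_inW u v : inW u -> tau_rel u v.
Proof. by move=> hu c b; rewrite (tau_perp c (proj1 hu)) -tau_KW //; apply: tv_KW. Qed.

Lemma s_A x v : inA x -> s x v = s x (pA v).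
Proof. by move=> hx; rewrite s_split pA_A // pW_A // E addr0. Qed.

(** After an element of [KA] has moved the A-component of [u] to [e], both vectors are orthogonal to
    [e] and the relation takes place in [G1]. *)
Lemma rel_perp u v : s (pA u) (pA v) = 0 -> tau_rel u v.
Proof.
have [p0 _|p0 uv] := eqVneq (pA u) 0; first exact/rel_inW/pA0_inW.
have [Kg ge] := toAP (pA_in u) p0; set g := toA _ in Kg ge.
have [Sg _] := Kg; have [_ _ KV] := KA_group; have Kg' := KV _ Kg.
have gpu : linv g (pA u) = e by rewrite -ge (linvK hs).
apply: (rel_KA Kg') => c b.
have eu : s e (linv g u) = 0 by rewrite (s_A _ e_in) pA_KA // gpu E.
have ev : s e (linv g v) = 0.
  by rewrite (s_A _ e_in) pA_KA // -gpu (Sp_iso _ _ (SpV hs Sg)).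
move: (linv g u) (linv g v) eu ev => x y ex ey.
rewrite !tau_perp //; last by rewrite (tvE hs) !E ex ey mulr0 addr0.
by rewrite -homG1_J ?tvJ //; [exact: tv_Sp | exact: tv_G1 | exact: tv_G1].
Qed.

(** The vector [x + y] is the image of [y] under a transvection along [x], so [tau (x + y)] is a
    conjugate of [tau y] by some [tau x], and conjugation by [tau u] can be computed on each. *)
Lemma rel_split u c x y b : s x y != 0 -> tau_rel x y -> tau_rel u x -> tau_rel u y ->
  tau_rel (tv s u c x) (tv s u c y) -> cj (tau u c) (tau (x + y) b) = tau (tv s u c (x + y)) b.
Proof.
move=> xy rxy rux ruy r.
have sum z w : s z w = s x y -> z + w = tv s z (s x y)^-1 w.
  by move=> e0; rewrite (tvE hs) e0 mulVf // scale1r addrC.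
rewrite linearD /= (sum x y) // -rxy cjJ rux ruy r -sum //.
by rewrite (Sp_iso _ _ (tv_Sp hs u c)).
Qed.

Lemma rel_c0 u v b : cj (tau u 0) (tau v b) = tau (tv s u 0 v) b.
Proof.
have t0 : tau u 0 = ag_one H by apply: (@agI _ (tau u 0)); rewrite -tauD addr0 ag1.
by rewrite t0 tvx0 // loneE /cj !agN.
Qed.

Section Dependent.
Hypothesis rel_dep : forall u v m, pW v = m *: pW u -> tau_rel u v.

Lemma rel_depA u v : inA v -> tau_rel u v.
Proof. by move=> hv; apply: (@rel_dep u v 0); rewrite pW_A // scale0r. Qed.

Lemma rel_nonperp u v : s (pW u) (pW v) != 0 -> tau_rel u v.
Proof.
move=> uv2 c b; have [->|c0] := eqVneq c 0; first exact: rel_c0.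
have [uv1|uv1] := eqVneq (s (pA u) (pA v)) 0; first exact: rel_perp.
(* [v = x + y] with [y] in the plane, and [l] chosen so that [tv s u c] moves [x] into [W]. *)
pose l := c * s (pW u) (pW v).
have l0 : l != 0 by rewrite mulf_neq0.
pose x := - l *: pA u + pW v; pose y := pA v + l *: pA u.
have hy : inA y by apply/inAD/inAZ; apply: pA_in.
have hx1 : inA (- l *: pA u) by apply/inAZ/pA_in.
have [xA xW] : pA x = - l *: pA u /\ pW x = pW v.
  by rewrite pA_AW ?pW_AW //; apply: pW_in.
have -> : v = x + y.
  by rewrite -{1}(pAW v) /x /y; apply: (s_inj hs) => z; rewrite !E; ring.
apply: rel_split.
- by rewrite s_split xA (pA_A hy) (pW_A hy) /y !E !mulr0 !addr0 mulf_neq0 // oppr_eq0.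
- exact: rel_depA.
- by apply: rel_perp; rewrite xA !E mulr0.
- exact: rel_depA.
- apply: rel_inW; apply: pA0_inW.
  rewrite (tvE hs) pAD pAZ xA -scalerDl s_split xA xW !E mulr0 add0r addNr.
  exact: scale0r.
Qed.

(** Writes [v] as [x + y] with [x] in W pairing to 1 with the W-component of [u]. Then each
    hypothesis of [rel_split] falls under [rel_inW], [rel_perp] or [rel_nonperp]. *)
Lemma rel_indep u v : (exists z : F, z != 0 /\ z != 1) -> (forall m, pW v <> m *: pW u) ->
  s (pW u) (pW v) = 0 -> tau_rel u v.
Proof.
move=> [z [z0 z1]] indep uv2 c b; have [->|c0] := eqVneq c 0; first exact: rel_c0.
have [uv1|uv1] := eqVneq (s (pA u) (pA v)) 0; first exact: rel_perp.
have [u0|u0] := eqVneq (pW u) 0.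
  by apply: rel_inA; rewrite -(pAW u) u0 addr0; apply: pA_in.
set d := s (pA u) (pA v) in uv1.
(* Here [q] will be the pairing of the W-components of [x] and [y], and [q + c * d] that of their
   images under [tv s u c]. One of 1 and [z] avoids both zeros. *)
have [q [q0 qd]] : exists q, q != 0 /\ q + c * d != 0.
  have [h|h] := eqVneq (1 + c * d) 0; last by exists 1; rewrite oner_neq0.
  exists z; split=> //; apply: contra z1 => /eqP h'; rewrite -subr_eq0.
  by apply/eqP; rewrite -h' -[RHS]subr0 -h; ring.
have [x0 [x0u x0v]] := dual_pair hs 1 q u0 indep.
pose x := pW x0; have hx : inW x by apply: pW_in.
have [xu xv] : s x (pW u) = 1 /\ s x (pW v) = q.
  by move: x0u x0v; rewrite (s_split x0) (s_split x0 (pW v)) !(pA_W (pW_in _)) !(pW_W (pW_in _)) !E !add0r.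
pose y := v - x; have -> : v = x + y by rewrite /y addrC subrK.
have yA : pA y = pA v by rewrite /y pAD -scaleN1r pAZ (pA_W hx) scaler0 addr0.
have yW : pW y = pW v - x by rewrite /y pWD -scaleN1r pWZ (pW_W hx) scaleN1r.
have uy : s (pW u) (pW y) = 1 by rewrite yW !E uv2 (sC hs) xu; ring.
have xy : s x (pW y) = q by rewrite yW !E xv subr0.
have [xA xW] : pA x = 0 /\ pW x = x by rewrite pA_W // pW_W.
clearbody y.
apply: rel_split.
- by rewrite s_split xA xW xy !E add0r.
- exact: rel_inW.
- by apply: rel_perp; rewrite xA !E.
- by apply: rel_nonperp; rewrite uy oner_neq0.
- apply: rel_nonperp; rewrite !(tvE hs) !pWD !pWZ xW.
  rewrite (s_split u x) (s_split u y) xA xW yA uy -/d !E xy uy xu (sC hs _ x) xu.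
  by apply: contra qd => /eqP h; apply/eqP; rewrite -h; ring.
Qed.
End Dependent.

(** * The homomorphism on Sp(V), obtained from its graph *)

Section Extension.
Hypotheses (rel_all : forall u v, s (pW u) (pW v) = 0 -> tau_rel u v)
  (rel_dep : forall u v m, pW v = m *: pW u -> tau_rel u v)
  (common_perp : forall u v w, exists y, [/\ y != 0, s y u = 0, s y v = 0 & s y w = 0]).

Lemma rel_any u v : tau_rel u v.
Proof.
by have [|uv] := eqVneq (s (pW u) (pW v)) 0; [exact: rel_all | exact: rel_nonperp].
Qed.

Definition lift_tv x a : liftG hs H :=
  exist (fun p : 'End(V) * H => Sp s p.1) (tv s x a, tau x a) (tv_Sp hs x a).
Definition lift_act (p : liftG hs H) : 'End(V) := (sval p).1.

(** Such words lie on the graph of [f1]; this is the freeness at [e] required by the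
    presentation. *)
Lemma lift_words_G1 p : words lift_tv (perp s e) p ->
  G1 (sval p).1 /\ (sval p).2 = f1 (sval p).1.
Proof.
have [G_1 GM GV] := G1_group.
elim=> [{}p [x [a [ex ->]]]||p1 p2 _ [h1 e1] _ [h2 e2]|p1 _ [h1 e1]] /=.
- by split; [exact: tv_G1 | exact: tau_perp].
- by split=> //; rewrite hom1_G1.
- by split; [exact: GM | rewrite e1 e2 homG1].
- by split; [exact: GV | rewrite e1 (homV hs (fun g h => proj1 h) G1_group homG1)].
Qed.

Lemma lift_free p : words lift_tv (@any_vec F V) p -> lift_act p = lone -> p = ag_one (liftG hs H).
Proof.
apply: (@transvection_presentation _ _ _ hs (liftG hs H) lift_act lift_tv e).
- by move=> q; apply: svalP q.
- by [].
- by [].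
- by move=> x a b; apply: lift_eq; rewrite /= tvD // tauD.
- by move=> c x a _; apply: lift_eq; rewrite /= tvZ // tauZ.
- by move=> u c v b; apply: lift_eq; rewrite /= (tvJ hs _ _ (tv_Sp hs u c)); congr pair; apply: rel_any.
- exact: common_perp.
- exact: e_neq0.
- move=> q /lift_words_G1[_ e2] q1; apply: lift_eq.
  by rewrite /lift_act in q1; rewrite [sval q]surjective_pairing e2 q1 hom1_G1.
Qed.

Lemma lift_ex g : Sp s g -> exists p, words lift_tv (@any_vec F V) p /\ (sval p).1 = g.
Proof.
move=> /(Sp_TG hs); apply: (TG_ind (K := fun g => exists p, words lift_tv (@any_vec F V) p /\ (sval p).1 = g)).
- split=> [|_ _ [p [wp <-]] [q [wq <-]]|_ [p [wp <-]]].
  + by exists (ag_one _); split=> //; apply: gen_one.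
  + by exists (p ** q); split=> //; apply: gen_mul.
  + by exists (p^i); split=> //; apply: gen_inv.
- by move=> x a _; exists (lift_tv x a); split=> //; apply: words_t.
Qed.

(** The subgroup of the product generated by the pairs [lift_tv x a] maps onto Sp(V) because
    transvections generate, and injectively by [lift_free]. It is therefore the graph of [phi]. *)
Theorem two_block_extension : exists phi : 'End(V) -> H,
  [/\ hom_on (Sp s) phi, (forall g, G1 g -> phi g = f1 g), (forall g, KA g -> phi g = fA g)
    & (forall x a, phi (tv s x a) = tau x a)].
Proof.
pose good g h := exists p, words lift_tv (@any_vec F V) p /\ sval p = (g, h).
pose phi g := epsilon (inhabits (ag_one H)) (good g).
have phiP p : words lift_tv (@any_vec F V) p -> phi (sval p).1 = (sval p).2.
  move=> wp; have [] : good (sval p).1 (phi (sval p).1).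
    by apply: epsilon_spec; exists (sval p).2, p; rewrite -surjective_pairing.
  move=> q [wq eq]; suff <- : q = p by rewrite eq.
  have /agVr -> : p^i ** q = ag_one (liftG hs H); last by rewrite agVV.
  apply: lift_free; first by apply: gen_mul => //; apply: gen_inv.
  by rewrite /lift_act /= eq /= (lmulV hs) //; apply: (svalP p).
have phiM : hom_on (Sp s) phi.
  move=> g g' /lift_ex[p [wp <-]] /lift_ex[q [wq <-]].
  by rewrite !phiP // -[RHS]/(sval (p ** q)).2 -phiP //; apply: gen_mul.
have phit x a : phi (tv s x a) = tau x a by rewrite -[RHS]/(sval (lift_tv x a)).2 -phiP //; apply: words_t.
exists phi; split=> //.
- move=> g [Sg ge]; have := perp_TG Sg ge.
  case/(TG_agree hs (Sp_group hs) G1_group phiM homG1) => // x a ex.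
  by split; [exact: tv_Sp | exact: tv_G1 | rewrite phit tau_perp].
- move=> g /KA_TG; case/(TG_agree hs (Sp_group hs) KA_group phiM homA) => // x a ex.
  by split; [exact: tv_Sp | exact: tv_KA | rewrite phit tau_inA].
Qed.
End Extension.

End TwoBlocks.

(** * Hyperbolic systems *)

Section HyperbolicSystem.
Variables (F : fieldType) (V : vectType F) (s : V -> V -> F).
Hypothesis hs : symplectic_form s.
Variables (n : nat) (h : nat -> V).

(** The basis property is recorded as triviality of the common orthogonal of the [h k]. In this form
    it passes to the complement of a hyperbolic plane without any computation with bases. *)
Definition hyperbolic_system :=
  (forall i j, (i < n)%N -> (j < n)%N ->
    [/\ s (h (2 * i)%N) (h (2 * j)%N) = 0,
        s (h (2 * i).+1) (h (2 * j).+1) = 0 &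
        s (h (2 * i)%N) (h (2 * j).+1) = (i == j)%:R]) /\
  (forall v, (forall k, (k < 2 * n)%N -> s (h k) v = 0) -> v = 0).

Lemma basis_system : hyperbolic_basis s n h -> hyperbolic_system.
Proof.
move=> [hb hp]; split=> // v hv; apply: (s_inj hs) => w; rewrite (s0r hs).
have [->|v0] := eqVneq v 0; first exact: (s0r hs).
(* Multiplying the functional [s x v] by the nonzero vector [v] turns it into an endomorphism, whose
   [lker] is the orthogonal of [v]. *)
have lin : linear (fun x => s x v *: v).
  by move=> c x y; rewrite !(sE hs) scalerDl scalerA.
have : w \in lker (linfun (fun x => s x v *: v)).
  have /subvP : (fullv <= lker (linfun (fun x => s x v *: v)))%VS; last by apply; apply: memvf.
  rewrite -(span_basis hb); apply/span_subvP => x /mapP[k]; rewrite mem_iota add0n => kn ->.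
  by rewrite memv_ker linear_lfun // hv ?scale0r.
by rewrite memv_ker linear_lfun // scaler_eq0 (negbTE v0) orbF => /eqP.
Qed.

Hypothesis sys : hyperbolic_system.

Lemma pair_ef i : (i < n)%N -> s (h (2 * i)%N) (h (2 * i).+1) = 1.
Proof. by move=> hi; case: sys => /(_ i i hi hi)[_ _ ->] _; rewrite eqxx. Qed.

Lemma pair0 i j : (i < 2 * n)%N -> (j < 2 * n)%N -> i./2 != j./2 -> s (h i) (h j) = 0.
Proof.
move=> hi hj ij; case: sys => hp _.
have hi2 : (i./2 < n)%N by lia.
have hj2 : (j./2 < n)%N by lia.
have [a b c] := hp _ _ hi2 hj2; have [_ _ d] := hp _ _ hj2 hi2.
have half k : k = (2 * k./2)%N \/ k = (2 * k./2).+1 by lia.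
case: (half i) => ->; case: (half j) => -> //.
- by rewrite c (negbTE ij).
- by rewrite (sC hs) d eq_sym (negbTE ij) oppr0.
Qed.

Lemma pair_ee i j : (i < n)%N -> (j < n)%N -> s (h (2 * i)%N) (h (2 * j)%N) = 0.
Proof. by move=> hi hj; case: sys => /(_ i j hi hj)[]. Qed.

(** Orthogonality to [u], [v], [w] imposes three linear conditions on the four coefficients of a
    combination of [h 0], ..., [h 3]; pairing with these four vectors shows the combination is
    nonzero. *)
Lemma common_perp_ex u v w : (2 <= n)%N ->
  exists y, [/\ y != 0, s y u = 0, s y v = 0 & s y w = 0].
Proof.
move=> n2; pose M : 'M[F]_(4, 3) := \matrix_(i, j) s (h i) [:: u; v; w]`_j.
have : kermx M != 0.
  by rewrite -mxrank_eq0 mxrank_ker; have := rank_leq_col M; case: (\rank M) => [|[|[|[|]]]].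
rewrite -nz_row_eq0; have : nz_row (kermx M) *m M = 0.
  by apply/sub_kermxP; apply: nz_row_sub.
move: (nz_row _) => c cM c0.
pose y := \sum_i c 0 i *: h i.
have sy z : s y z = \sum_i c 0 i * s (h i) z.
  rewrite /y; elim/big_rec2: _ => [|i a b _ IH]; first exact: (s0l hs).
  by rewrite !(sE hs) IH.
have yM (j : 'I_3) : s y [:: u; v; w]`_j = 0.
  have := congr1 (fun A : 'M__ => A 0 j) cM; rewrite !mxE => <-.
  by rewrite sy; apply: eq_bigr => i _; rewrite mxE.
exists y; split; first last.
- exact: (yM (@Ordinal 3 2 isT)).
- exact: (yM (@Ordinal 3 1 isT)).
- exact: (yM (@Ordinal 3 0 isT)).
apply: contra c0 => /eqP y0.
have p01 := @pair_ef 0 (ltac:(lia)); have p23 := @pair_ef 1 (ltac:(lia)).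
have p i j : (i < 4)%N -> (j < 4)%N -> i./2 != j./2 -> s (h i) (h j) = 0.
  by move=> hi hj; apply: pair0; lia.
have sy0 z : \sum_i c 0 i * s (h i) z = 0 by rewrite -sy y0 (s0l hs).
have e k : \sum_i c 0 i * s (h i) (h k) = c 0 (inord 0) * s (h 0) (h k) +
   c 0 (inord 1) * s (h 1) (h k) + c 0 (inord 2) * s (h 2) (h k) + c 0 (inord 3) * s (h 3) (h k).
  rewrite !big_ord_recr big_ord0 /= add0r.
  by congr (c 0 _ * _ + c 0 _ * _ + c 0 _ * _ + c 0 _ * _); apply: val_inj; rewrite /= inordK.
apply/eqP/rowP => i; rewrite mxE.
have := (sy0 (h 0), sy0 (h 1), sy0 (h 2), sy0 (h 3)); rewrite !e !(ss hs).
rewrite !(p 0 2, p 0 3, p 1 2, p 1 3, p 2 0, p 2 1, p 3 0, p 3 1) //.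
rewrite (sC hs (h 1)) (sC hs (h 3)) p01 p23.
rewrite !mulr0 !mulr1 !mulrN1 !add0r !addr0 => -[[[/eqP c1 c_0] /eqP c3] c_2].
rewrite !oppr_eq0 in c1 c3.
have : i = inord i :> 'I_4 by rewrite inord_val.
by case: i => -[|[|[|[|]]]] //= ? ->; rewrite ?c_0 ?c_2 ?(eqP c1) ?(eqP c3).
Qed.

End HyperbolicSystem.

(** * The amalgam of maximal parabolics *)

Section Parabolic.
Variables (F : fieldType) (V : vectType F) (s : V -> V -> F).
Hypothesis hs : symplectic_form s.
Variables (n : nat) (h : nat -> V).
Hypotheses (n2 : (2 <= n)%N) (sys : hyperbolic_system s n h)
  (span_h : (<<mkseq h (2 * n)>> = fullv)%VS).
Let E := (sE hs).
Notation C := (std_chamber h).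
Let e := h 0.
Let f := h 1.
(** With indices from 0, [y] and [z] are the last pair, and the member of dimension [(2 * n).-1] of
    the chamber is the orthogonal of [y]. Its stabilizer is thus that of the line of [y]. *)
Let y := h (2 * n.-1)%N.
Let z := h (2 * n.-1).+1.

Definition stab_C k (g : 'End(V)) := Sp s g /\ (g @: C k)%VS = C k.

Lemma mem_C i k : (i < k)%N -> h i \in C k.
Proof. by move=> ik; apply: memv_span; apply/mapP; exists i; rewrite ?mem_iota. Qed.

Lemma C_sub k (U : {vspace V}) : (forall i, (i < k)%N -> h i \in U) -> (C k <= U)%VS.
Proof. by move=> hU; apply/span_subvP => _ /mapP[i ik ->]; apply: hU; rewrite mem_iota in ik. Qed.

Lemma stab_C_intro k g : Sp s g -> (forall i, (i < k)%N -> g (h i) \in C k) -> stab_C k g.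
Proof.
move=> Sg hg; split=> //; apply/eqP; rewrite eqEdim limg_dim_eq ?leqnn; last first.
  by rewrite (eqP (Sp_ker hs Sg)) capv0.
by rewrite andbT /std_chamber limg_span; apply/span_subvP => _ /mapP[_ /mapP[i ik ->] ->];
  apply: hg; rewrite mem_iota in ik.
Qed.

Lemma stab_C_group k : group_pred (stab_C k).
Proof.
have [S1 SM SV] := Sp_group hs; split.
- by split=> //; rewrite /lone lim1g.
- by move=> g g' [Sg gC] [Sg' gC']; split; [exact: SM | rewrite /lmul limg_comp gC' gC].
- move=> g [Sg gC]; split; first exact: SV.
  by rewrite -{1}gC -limg_comp -/(lmul (linv g) g) (lmulV hs) // /lone lim1g.
Qed.

Lemma ef_pair : s e f = 1. Proof. by apply: (pair_ef sys (i := 0)); lia. Qed.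
Lemma yz_pair : s y z = 1. Proof. by apply: (pair_ef sys); lia. Qed.

Lemma C_perp_y i : (i < (2 * n).-1)%N -> s (h i) y = 0.
Proof.
move=> hi; have [->|ne] := eqVneq i (2 * n.-1)%N; first exact: (ss hs).
by apply: (pair0 hs sys); lia.
Qed.

Lemma C_perp_z i : (i < 2 * n.-1)%N -> s (h i) z = 0.
Proof. by move=> hi; apply: (pair0 hs sys); lia. Qed.

Lemma perp_hC k v : (forall i, (i < k)%N -> s (h i) v = 0) -> forall c, c \in C k -> s c v = 0.
Proof.
move=> hv c; have [->|v0] := eqVneq v 0; first by rewrite (s0r hs).
have lin : linear (fun x => s x v *: v) by move=> d x w; rewrite !(sE hs) scalerDl scalerA.
have /subvP sub : (C k <= lker (linfun (fun x => s x v *: v)))%VS.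
  by apply: C_sub => i ik; rewrite memv_ker linear_lfun // hv ?scale0r.
by move/sub; rewrite memv_ker linear_lfun // scaler_eq0 (negbTE v0) orbF => /eqP.
Qed.

Lemma y_perp v : s y v = 0 -> v \in C (2 * n).-1.
Proof.
have : v \in <<mkseq h (2 * n)>>%VS by rewrite span_h memvf.
have -> : (2 * n = (2 * n).-1.+1)%N by lia.
rewrite mkseqS -cats1 span_cat span_seq1 => /memv_addP[x xC [_ /vlineP[c ->] ->]].
have -> : h (2 * n).-1 = z by rewrite /z; congr h; lia.
rewrite !E yz_pair mulr1 (sC0 hs (perp_hC C_perp_y xC)) add0r => ->.
by rewrite scale0r addr0.
Qed.

Lemma stab_y g m : Sp s g -> g y = m *: y -> stab_C (2 * n).-1 g.
Proof.
move=> Sg gy; apply: stab_C_intro => // i hi; apply: y_perp.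
have m0 : m != 0.
  apply: contraNneq (oner_neq0 F) => m0; rewrite -yz_pair -(Sp_iso _ _ Sg) gy m0 scale0r.
  by rewrite (s0l hs).
by apply: (mulfI m0); rewrite -(sZl hs) -gy (Sp_iso _ _ Sg) mulr0; apply/(sC0 hs)/C_perp_y.
Qed.

Lemma stab_y_inv g : stab_C (2 * n).-1 g -> exists m, g y = m *: y.
Proof.
move=> [Sg gC]; exists (s (g y) z); apply: (s_inj hs) => w.
have gyv v : s y v = 0 -> s (g y) v = 0.
  move/y_perp; rewrite -gC => /memv_imgP[c cC ->]; rewrite (Sp_iso _ _ Sg).
  exact/(sC0 hs)/(perp_hC C_perp_y cC).
have := gyv (w - s y w *: z); rewrite !E yz_pair mulr1 subrr => /(_ erefl) /eqP.
rewrite subr_eq0 => /eqP h1; rewrite (sC hs) h1 (sC hs w y); ring.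
Qed.

Lemma y_inW : inW s e f y.
Proof. by split; apply: C_perp_y; lia. Qed.

Lemma y_neq0 : y != 0.
Proof. by apply: contraNneq (oner_neq0 F) => y_neq0; rewrite -yz_pair y_neq0 (s0l hs). Qed.

Lemma KA_y g : KA s e f g -> g y = y.
Proof. by case=> _; apply; apply: y_inW. Qed.

Lemma stab_y1 g : Sp s g -> g y = y -> stab_C (2 * n).-1 g.
Proof. by move=> Sg gy; apply: (@stab_y _ 1); rewrite ?scale1r. Qed.

Lemma stab_e g m : Sp s g -> g e = m *: e -> stab_C 1 g.
Proof.
move=> Sg ge; apply: stab_C_intro => // -[] // _; rewrite -/e ge.
exact/memvZ/(@mem_C 0).
Qed.

Lemma G1_stab g : G1 s e g -> stab_C 1 g.
Proof. by case=> Sg ge; apply: (@stab_e _ 1); rewrite ?scale1r. Qed.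

Lemma KA_stab g : KA s e f g -> stab_C 2 g.
Proof.
move=> Kg; apply: stab_C_intro; first by case: Kg.
have inC x : inA s e f x -> x \in C 2.
  move=> hx; rewrite -(pA_A hs ef_pair hx) (pAE s e f); apply: memvD; apply: memvZ; exact: mem_C.
by move=> [|[|]] // _; apply/inC/(KA_in Kg) => w [].
Qed.

Lemma KW_stab g : KW s e f g -> stab_C 2 g.
Proof.
move=> [Sg ge gf]; apply: stab_C_intro => //.
by move=> [|[|]] // _; rewrite -/e -/f ?ge ?gf; apply: mem_C.
Qed.

Definition stab_any (g : 'End(V)) := exists2 k, (0 < k < 2 * n)%N & stab_C k g.

(** A transvection lies in [KW], or is conjugate under [KA] to one fixing [e]. The groups [KA] and
    [KW] stabilize [C 2], and [G1] stabilizes [C 1]. *)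
Lemma stab_generate g : Sp s g -> gen_by (@lmul F V) lone (@linv F V) stab_any g.
Proof.
move=> Sg; have := Sp_TG hs Sg.
apply: (TG_ind (K := gen_by (@lmul F V) lone (@linv F V) stab_any)).
  split; [exact: gen_one | exact: gen_mul | exact: gen_inv].
move=> x a _.
have [p0|p0] := eqVneq (pA s e f x) 0.
  by apply: gen_in; exists 2; [lia | apply/KW_stab/(tv_KW hs)/(pA0_inW hs ef_pair)].
have [g0 [Kg ge]] := KA_trans hs ef_pair (@pA_in _ _ _ hs e f x) p0.
have -> : x = g0 (e + pW s e f x).
  rewrite linearD /= ge; case: Kg => _ ->; rewrite ?(pAW s e f) //; exact: (pW_in hs ef_pair).
rewrite -(tvJ hs) //; last by case: Kg.
have Sk : gen_by (@lmul F V) lone (@linv F V) stab_any g0.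
  by apply: gen_in; exists 2; [lia | apply: KA_stab].
apply: gen_mul; [apply: gen_mul | apply: gen_inv] => //.
apply: gen_in; exists 1; first lia.
by apply/G1_stab/(G1_eW hs)/(pW_in hs ef_pair).
Qed.

Variables (H : abs_group) (phi0 : 'End(V) -> H).
Hypothesis hom0 : forall k, (0 < k < 2 * n)%N -> hom_on (stab_C k) phi0.

(** The stabilizers of [C 1] and [C 2] provide the data for the two blocks. The stabilizer of the
    largest member provides the relations between vectors whose W-components are orthogonal. *)
Lemma stab_extend : exists phi : 'End(V) -> H, hom_on (Sp s) phi /\
  forall k g, (0 < k < 2 * n)%N -> stab_C k g -> phi g = phi0 g.
Proof.
have [[P1 P2] P3] : (hom_on (stab_C 1) phi0 * hom_on (stab_C 2) phi0) * hom_on (stab_C (2 * n).-1) phi0.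
  by do !split; apply: hom0; lia.
have homA : hom_on (KA s e f) phi0 by move=> g k /KA_stab ? /KA_stab ?; apply: P2.
have homG1 : hom_on (G1 s e) phi0 by move=> g k /G1_stab ? /G1_stab ?; apply: P1.
pose Gy g := Sp s g /\ g y = y.
have Gy_group : group_pred Gy := G1_group hs y.
have homGy : hom_on Gy phi0 by move=> g k [? ?] [? ?]; apply: P3; apply: stab_y1.
have KA_Gy g : KA s e f g -> Gy g by move=> Kg; split; [case: Kg | apply: KA_y].
have comm g k : KA s e f g -> KW s e f k -> phi0 g ** phi0 k = phi0 k ** phi0 g.
  move=> Kg Kk; rewrite -!P2; try exact: KA_stab; try exact: KW_stab.
  by congr phi0; apply: (KA_KW_commute hs ef_pair).
have torus k m w a : KA s e f k -> k e = m *: e -> inW s e f w ->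
    cj (phi0 k) (phi0 (tv s (e + w) a)) = phi0 (tv s (m *: e + w) a).
  move=> Kk ke hw; have Sk : Sp s k by case: Kk.
  have -> : m *: e + w = k (e + w) by rewrite linearD /= ke; case: Kk => _ ->.
  rewrite -(tvJ hs) // (homJ hs (fun g h => proj1 h) (stab_C_group 1) P1) //.
    exact: stab_e ke.
  exact/G1_stab/(G1_eW hs)/hw.
pose T := tau s e f phi0 phi0.
have TA g v a : KA s e f g -> T (g v) a = cj (phi0 g) (T v a).
  by move=> Kg; apply: (tau_KA hs ef_pair).
have Te v a : s e v = 0 -> T v a = phi0 (tv s v a) by move=> ev; apply: (tau_perp hs ef_pair).
(* Since [KA] fixes [y], the conjugation defining [T v a] takes place inside [Gy], where [phi0] is
   also a homomorphism. *)
have Ty v a : s y v = 0 -> T v a = phi0 (tv s v a).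
  move=> yv; have [p0|p0] := eqVneq (pA s e f v) 0.
    by apply: Te; case: (pA0_inW hs ef_pair p0).
  have [g0 [Kg ge]] := KA_trans hs ef_pair (@pA_in _ _ _ hs e f v) p0.
  have ev : v = g0 (e + pW s e f v).
    rewrite linearD /= ge; case: (Kg) => _ ->; rewrite ?(pAW s e f) //; exact: (pW_in hs ef_pair).
  have eW : s e (pW s e f v) = 0 by case: (pW_in hs ef_pair v).
  rewrite {1}ev TA // Te ?E ?eW ?addr0 // -(homJ hs (fun g h => proj1 h) Gy_group homGy).
  - by rewrite (tvJ hs) -?ev //; case: Kg.
  - exact: KA_Gy.
  - split; first exact: tv_Sp.
    apply/(tv_fix hs)/(sC0 hs).
    by rewrite -(Sp_iso _ _ (proj1 Kg)) -ev KA_y.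
(* Moving the W-component of [u] to [y] by [KW] makes both vectors orthogonal to [y], so the
   relation can be read in [Gy]. *)
have relW u v : s (pW s e f u) (pW s e f v) = 0 -> tau_rel s e f phi0 phi0 u v.
  move=> uv; have [u0|u0] := eqVneq (pW s e f u) 0.
    apply: (rel_inA hs ef_pair) => //; rewrite -(pAW s e f u) u0 addr0; exact: (pA_in hs).
  have [g [Kg gu]] := KW_trans hs ef_pair (pW_in hs ef_pair u) y_inW u0 y_neq0.
  have Sg : Sp s g by case: Kg.
  apply: (rel_KW hs ef_pair) (Kg) _ => //.
  have yW x : s y x = s y (pW s e f x).
    by rewrite -{1}(pAW s e f x) E (inAW hs (pA_in hs _) y_inW) add0r.
  have yu : s y (g u) = 0 by rewrite yW (pW_KW hs ef_pair) // gu E.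
  have yv : s y (g v) = 0 by rewrite yW (pW_KW hs ef_pair) // -gu (Sp_iso _ _ Sg).
  move: (g u) (g v) yu yv => u' v' yu yv c b.
  rewrite -/(T u' c) -/(T v' b) -/(T _ _) !Ty //; last by rewrite (tvE hs) !E yu yv mulr0 addr0.
  have tG x a : s y x = 0 -> Gy (tv s x a).
    by move=> yx; split; [exact: tv_Sp | apply/(tv_fix hs)/(sC0 hs)].
  by rewrite -(homJ hs (fun g h => proj1 h) Gy_group homGy) ?(tvJ hs) //; [exact: tv_Sp | exact: tG..].
have [] := @two_block_extension _ _ _ hs e f ef_pair H phi0 phi0 homA homG1 comm _ torus relW _ _.
- by [].
- by move=> u v m uv; apply: relW; rewrite uv !E mulr0.
- by move=> u v w; apply: (common_perp_ex hs sys).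
move=> phi [homphi phi1 phiA phit]; exists phi; split=> //.
have phiy g : Gy g -> phi g = phi0 g.
  move=> [Sg gy]; have := perp_TG hs Sg gy.
  case/(TG_agree hs (Sp_group hs) Gy_group homphi homGy) => // x a yx.
  split; [exact: tv_Sp | | by rewrite phit -/(T x a) Ty].
  by split; [exact: tv_Sp | apply/(tv_fix hs)/(sC0 hs)].
move=> k g hk Pg; have Sg : Sp s g by case: Pg.
(* In the top case [g] multiplies [y] by a scalar; dividing by an element of [KW] with the same
   effect on [y] leaves an element of [Gy]. In the remaining cases [z] is still orthogonal to
   [C k]. *)
have [kn|kn] := leqP k (2 * n.-1)%N; last first.
  have ek : k = (2 * n).-1 by lia.
  rewrite ek in Pg; have [m gy] := stab_y_inv Pg.
  have my0 : m *: y != 0 by rewrite -gy; apply: (Sp_neq0 hs) y_neq0.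
  have [k0 [Kk ky]] := KW_trans hs ef_pair y_inW (inWZ hs m y_inW) y_neq0 my0.
  have Sk : Sp s k0 by case: Kk.
  have Gk : Gy (lmul (linv k0) g).
    by split; [apply: (SpM hs) => //; apply: (SpV hs) | rewrite lmulE gy -ky (linvK hs)].
  have -> : g = lmul k0 (lmul (linv k0) g) by rewrite lmulA (lmulVr hs) ?lmul1.
  rewrite homphi //; last by case: Gk.
  rewrite (phi1 _ (KW_G1 Kk)) phiy // -P3 //; first exact: stab_y ky.
  by case: Gk; apply: stab_y1.
have [_ gC] := Pg.
(* [g = (g p^-1) p], where [p] fixes [C k] pointwise, hence [e], and [g p^-1] fixes [y]. *)
pose Q x := forall c, c \in C k -> s x c = 0.
have Qg x : Q x -> Q (linv g x).
  move=> Qx c cC; rewrite -(Sp_iso _ _ Sg) (linvVK hs) //; apply: Qx.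
  by rewrite -gC; apply/memv_imgP; exists c.
have Qy : Q y by move=> c cC; apply/(sC0 hs)/(perp_hC _ cC) => i ik; apply: C_perp_y; lia.
have Qz : Q z by move=> c cC; apply/(sC0 hs)/(perp_hC _ cC) => i ik; apply: C_perp_z; lia.
have zy : s z y != 0 by rewrite (sC hs) yz_pair oppr_eq0 oner_neq0.
have [||||||p [Tp py]] := @TG_trans _ _ _ hs Q _ _ (linv g y) y.
- by move=> a b Qa Qb c cC; rewrite E Qa // Qb // addr0.
- by move=> a b Qa Qb c cC; rewrite !E Qa // Qb // subr0.
- exact: Qg.
- exact: Qy.
- by exists (linv g z); [exact: Qg | rewrite (Sp_iso _ _ (SpV hs Sg))].
- by exists z.
have Sp_p := TG_Sp hs Tp.
have pfix c : c \in C k -> p c = c.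
  by move=> cC; apply: (TG_fix hs _ Tp) => x Qx; apply: Qx.
have [Pone PM PV] := stab_C_group k.
have Pp : stab_C k p by apply: stab_C_intro => // i ik; rewrite pfix mem_C.
have eg : g = lmul (lmul g (linv p)) p by rewrite -lmulA (lmulV hs) // lmulr1.
have Pq : stab_C k (lmul g (linv p)) by apply: PM => //; apply: PV.
rewrite {1}eg homphi //; last by case: Pq.
rewrite phiy; last first.
  by split; [case: Pq | rewrite lmulE -py (linvK hs) // (linvVK hs)].
rewrite phi1 -?(hom0 hk) // -?eg //; split=> //; apply: pfix; apply: mem_C; lia.
Qed.

End Parabolic.

(** * The stabilizer of a vector as a Heisenberg extension *)

Section Eichler.
Variables (F : fieldType) (V : vectType F) (s : V -> V -> F).
Hypothesis hs : symplectic_form s.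
Variables (e f : V).
Hypothesis ef : s e f = 1.
Let E := (sE hs).
Implicit Types (u v w : V) (g k : 'End(V)).
Notation inW := (inW s e f).
Notation KW := (KW s e f).

(** The Eichler, or Siegel, transformation: for [w] in W it fixes [e] and sends [f] to [f + w].
    Together with the transvections along [e] these form the Heisenberg group on W. *)
Definition eich w : 'End(V) := linfun (fun v => v + s w v *: e + s e v *: w).

Lemma eichE w v : eich w v = v + s w v *: e + s e v *: w.
Proof.
rewrite linear_lfun // => c x y; apply: (s_inj hs) => z.
by rewrite !E; ring.
Qed.

Lemma eich_Sp w : inW w -> Sp s (eich w).
Proof.
case=> ew fw; apply: SpP => // u v; rewrite !eichE !E ew (sC0 hs ew) (sC hs u w) (sC hs u e).
by ring.
Qed.

Lemma inW0 : inW 0. Proof. by split; rewrite E. Qed.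

Lemma eich_e w : inW w -> eich w e = e.
Proof. by case=> ew fw; rewrite eichE (sC0 hs ew) (ss hs) !scale0r !addr0. Qed.

Lemma eich_f w : inW w -> eich w f = f + w.
Proof. by case=> ew fw; rewrite eichE (sC0 hs fw) ef scale0r addr0 scale1r. Qed.

Lemma eich0 : eich 0 = lone.
Proof. by apply/lfunP => v; rewrite eichE loneE E scale0r scaler0 !addr0. Qed.

Lemma eichD u v : inW u -> inW v -> lmul (eich u) (eich v) = lmul (tv s e (s u v)) (eich (u + v)).
Proof.
move=> [eu _] [ev _]; apply/lfunP => x; apply: (s_inj hs) => z.
by rewrite !lmulE (tvE hs) !eichE !E eu ev (sC0 hs eu); ring.
Qed.

Lemma eich_tv m w a : inW w ->
  tv s (m *: e + w) a = lmul (lmul (tv s e (m ^+ 2 * a)) (eich ((m * a) *: w))) (tv s w a).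
Proof.
move=> [ew _]; apply/lfunP => x; apply: (s_inj hs) => z.
by rewrite !lmulE !(tvE hs) !eichE !E ew; ring.
Qed.

Lemma eichJ g m w : Sp s g -> g e = m *: e -> g w = w ->
  lmul (lmul g (eich w)) (linv g) = eich (m *: w).
Proof.
move=> Sg ge gw; apply/lfunP => x; rewrite !lmulE !eichE !linearD !linearZ /= (linvVK hs) // ge gw.
rewrite -(Sp_iso w _ Sg) -(Sp_iso e _ Sg) (linvVK hs) // ge gw.
by apply: (s_inj hs) => z; rewrite !E; ring.
Qed.

Lemma eichJ_KW g w : KW g -> lmul (lmul g (eich w)) (linv g) = eich (g w).
Proof.
case=> Sg ge _; apply/lfunP => x; rewrite !lmulE !eichE !linearD !linearZ /= (linvVK hs) // ge.
by rewrite -(Sp_iso w _ Sg) -(Sp_iso e _ Sg) (linvVK hs) // ge.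
Qed.

Lemma eich_KW g w : KW g -> lmul g (eich w) = lmul (eich (g w)) g.
Proof.
by move=> Kg; rewrite -eichJ_KW // -lmulA (lmulV hs) ?lmulr1 //; case: Kg.
Qed.

Lemma eich_comm_e w a : inW w -> lmul (eich w) (tv s e a) = lmul (tv s e a) (eich w).
Proof.
by move=> hw; rewrite (tvJ' hs) ?eich_e //; apply: eich_Sp.
Qed.

(** * Rebuilding the stabilizer of [e] from Sp(W) and the Eichler elements of one plane in W *)

Variables (e2 f2 : V).
Hypotheses (ef2 : s e2 f2 = 1) (e2W : inW e2) (f2W : inW f2).
Notation inB := (inA s e2 f2).
Notation KB := (KA s e2 f2).

Lemma KB_KW g : KB g -> KW g.
Proof.
case: e2W f2W => ee2 fe2 [ef2' ff2] [Sg hg].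
by split=> //; apply: hg; split; apply: (sC0 hs).
Qed.

Lemma inB_W w : inB w -> inW w.
Proof. by move/(pA_A hs ef2) <-; rewrite pAE; apply: (inWD hs); apply: (inWZ hs). Qed.

Variables (H : abs_group) (fW q : 'End(V) -> H) (Q : 'End(V) -> Prop).
Hypotheses (big : exists c : F, c != 0 /\ c != 1)
  (homW : hom_on KW fW) (Q_Sp : forall g, Q g -> Sp s g)
  (Q_group : group_pred Q) (homQ : hom_on Q q)
  (Qeich : forall w, inB w -> Q (eich w)) (Qtv : forall a, Q (tv s e a))
  (QB : forall g, KB g -> Q g /\ q g = fW g)
  (comm_e : forall a k, KW k -> q (tv s e a) ** fW k = fW k ** q (tv s e a))
  (comm_eich : forall k, KW k -> k e2 = e2 -> q (eich e2) ** fW k = fW k ** q (eich e2)).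

Definition zeta a := q (tv s e a).

Lemma zetaD a b : zeta (a + b) = zeta a ** zeta b.
Proof. by rewrite /zeta (tvD hs) homQ. Qed.

Lemma zeta0 : zeta 0 = ag_one H.
Proof. by apply: (@agI _ (zeta 0)); rewrite -zetaD addr0 ag1. Qed.

Lemma e2_neq0 : e2 != 0. Proof. exact: (e_neq0 hs ef2). Qed.

Definition toW w : 'End(V) := epsilon (inhabits lone) (fun k => KW k /\ k e2 = w).

(* The image in [H] of [eich w]. *)
Definition nu w : H := if w == 0 then ag_one H else cj (fW (toW w)) (q (eich e2)).

(** Two elements of [KW] with the same value at [e2] differ by one fixing [e2], and [comm_eich]
    makes it commute with [q (eich e2)]. Hence any [k] may replace the chosen [toW]. *)
Lemma nuE k : KW k -> nu (k e2) = cj (fW k) (q (eich e2)).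
Proof.
move=> Kk; have Sk : Sp s k by case: Kk.
have [_ KM KV] := KW_group hs e f.
have ke0 := Sp_neq0 hs Sk e2_neq0; rewrite /nu (negbTE ke0).
have [K0 k0] : KW (toW (k e2)) /\ toW (k e2) e2 = k e2.
  apply: (epsilon_spec (inhabits lone) (fun g => KW g /\ g e2 = k e2)).
  by apply: (KW_trans hs ef e2W (KW_in Kk e2W) e2_neq0 ke0).
move: (toW _) K0 k0 => g K0 g0; have Sg : Sp s g by case: K0.
pose r := lmul (linv g) k.
have Kr : KW r by apply: KM => //; apply: KV.
have re : r e2 = e2 by rewrite lmulE -g0 (linvK hs).
have -> : k = lmul g r by rewrite lmulA (lmulVr hs) ?lmul1.
by rewrite homW // cjMl (cj_commute (esym (comm_eich Kr re))).
Qed.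

Lemma nu_ex w : inW w -> w != 0 -> exists2 k, KW k & w = k e2.
Proof.
by move=> hw w0; have [k [Kk <-]] := KW_trans hs ef e2W hw e2_neq0 w0; exists k.
Qed.

Lemma nu0 : nu 0 = ag_one H. Proof. by rewrite /nu eqxx. Qed.

Lemma nu_KW k w : KW k -> inW w -> nu (k w) = cj (fW k) (nu w).
Proof.
move=> Kk hw; have [->|w0] := eqVneq w 0; first by rewrite linear0 nu0 cj1.
have [_ KM _] := KW_group hs e f.
have [k0 K0 ->] := nu_ex hw w0; rewrite -lmulE !nuE //; last exact: KM.
by rewrite homW // cjMl.
Qed.

Lemma nu_B w : inB w -> nu w = q (eich w).
Proof.
move=> hw; have [->|w0] := eqVneq w 0; first by rewrite nu0 eich0 (hom1 Q_group homQ).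
have [k [Kk kw]] := KA_trans hs ef2 hw w0; have Kk' := KB_KW Kk.
have [Qk qk] := QB Kk.
rewrite -kw nuE // -qk -(homJ hs Q_Sp Q_group homQ) ?eichJ_KW //.
by apply: Qeich; apply: e_in.
Qed.

Lemma nu_zeta a w : inW w -> zeta a ** nu w = nu w ** zeta a.
Proof.
move=> hw; have [->|w0] := eqVneq w 0; first by rewrite nu0 ag1 ag_mul1.
have [k Kk ->] := nu_ex hw w0; rewrite nuE //.
have hq : zeta a ** q (eich e2) = q (eich e2) ** zeta a.
  have Qe : Q (eich e2) by apply: Qeich; apply: e_in.
  by rewrite /zeta -!homQ // eich_comm_e.
have hk := comm_e a Kk; rewrite -/(zeta a) in hk.
by apply: commute_cj; rewrite -cjMl hk cjMl (cj_commute hq).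
Qed.

Lemma nuD_img k u v : KW k -> inB u -> inB v ->
  nu (k u) ** nu (k v) = zeta (s (k u) (k v)) ** nu (k u + k v).
Proof.
move=> Kk hu hv; have [Sk _ _] := Kk; have [hu' hv'] := (inB_W hu, inB_W hv).
have huv : inB (u + v) by apply: (inAD hs).
have huv' := inB_W huv.
rewrite -linearD !nu_KW // -cjM (Sp_iso _ _ Sk) !nu_B // -homQ; try exact: Qeich.
rewrite eichD // homQ //; last exact: Qeich.
by rewrite cjM (cj_commute (esym (comm_e _ Kk))).
Qed.

(** Some element of [KW] takes [e2] and [s u v *: f2] to [u] and [v], so the identity is transported
    from the plane of [e2] and [f2]. *)
Lemma nuD_nonperp u v : inW u -> inW v -> s u v != 0 ->
  nu u ** nu v = zeta (s u v) ** nu (u + v).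
Proof.
move=> hu hv uv.
have u0 : u != 0 by apply: contra uv => /eqP->; rewrite E.
have [k Kk eu] := nu_ex hu u0; have Sk : Sp s k by case: Kk.
pose c := s u v.
have [|||g [Tg gu gv]] := @TG_trans_pair _ _ _ hs inW (inWD hs (f := f)) (inWB hs (f := f)) u (k (c *: f2)) v hu _ hv.
- exact/(KW_in Kk)/(inWZ hs).
- by rewrite eu (Sp_iso _ _ Sk) E ef2 mulr1.
- by rewrite eu (Sp_iso _ _ Sk) E ef2 mulr1 -eu.
have Kg := TG_KW hs Tg; have [_ KM _] := KW_group hs e f.
have -> : u = lmul g k e2 by rewrite lmulE -eu.
have -> : v = lmul g k (c *: f2) by rewrite lmulE gv.
apply: nuD_img; [exact: KM | exact: e_in | by apply: (inAZ hs); apply: f_in].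
Qed.

Lemma nuD u v : inW u -> inW v -> nu u ** nu v = zeta (s u v) ** nu (u + v).
Proof.
move=> hu hv; have [uv|uv] := eqVneq (s u v) 0; last exact: nuD_nonperp.
have [->|u0] := eqVneq u 0; first by rewrite nu0 E zeta0 !ag_mul1 add0r.
have [[m ->]|dep] := classic (exists m, v = m *: u).
  have [k Kk ->] := nu_ex hu u0; rewrite -linearZ.
  by apply: nuD_img => //; [exact: e_in | by apply: (inAZ hs); apply: e_in].
(* [x] pairs nontrivially with [u], [v] and [u + v], so [nuD_nonperp] applies to all steps of
   [nu u ** nu v = nu u ** nu (v - x) ** nu x]. *)
have [z [z0 z1]] := big.
(* These values make the three pairings that occur below equal to [z], 1 and [z - 1]. *)
have [|x0 [x0u x0v]] := dual_pair hs 1 (- z) u0 (v := v); first by move=> m ev; apply: dep; exists m.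
pose x := pW s e f x0; have hx : inW x by apply: (pW_in hs ef).
have px w : inW w -> s x w = s x0 w.
  by move=> hw; rewrite (s_split hs ef x0) (pA_W hs hw) (pW_W hs hw) E add0r.
have [xu xv] : s x u = 1 /\ s x v = - z by rewrite !px.
clearbody x.
have vx : nu (v - x) ** nu x = zeta (s (v - x) x) ** nu v.
  rewrite nuD_nonperp ?subrK //; first exact: (inWB hs).
  by rewrite !E subr0 (sC hs) xv opprK.
have uvx : nu u ** nu (v - x) = zeta (s u (v - x)) ** nu (u + (v - x)).
  apply: nuD_nonperp => //; first exact: (inWB hs).
  by rewrite !E uv (sC hs) xu add0r opprK oner_neq0.
have uvxx : nu (u + (v - x)) ** nu x = zeta (s (u + (v - x)) x) ** nu (u + v).
  rewrite nuD_nonperp ?addrA ?subrK //; first by apply: (inWB hs) => //; apply: (inWD hs).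
  by rewrite !E subr0 (sC hs u) (sC hs v) xu xv opprK addrC subr_eq0.
have -> : nu v = (zeta (s (v - x) x))^i ** (nu (v - x) ** nu x) by rewrite vx agVK.
have hvx : inW (v - x) by apply: (inWB hs).
have zV a : (zeta a)^i = zeta (- a) by apply/esym/agVr; rewrite -zetaD subrr zeta0.
rewrite zV ag_mulA -nu_zeta // agA (ag_mulA (nu u)) uvx agA uvxx !ag_mulA -!zetaD.
by congr (zeta _ ** _); rewrite !E uv (sC hs u x) (sC hs v x) xu xv; ring.
Qed.

(** For [g] in the stabilizer of [e] one has [g f = a *: e + f + w], from which the factors of
    [g = tv s e a] times [eich w] times an element of [KW] are read off. *)
Definition heis g := let a := s (g f) f in let w := pW s e f (g f) in
  zeta a ** nu w ** fW (lmul (linv (eich w)) (lmul (tv s e (- a)) g)).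

Lemma heisE a w k : inW w -> KW k ->
  heis (lmul (lmul (tv s e a) (eich w)) k) = zeta a ** nu w ** fW k.
Proof.
move=> hw Kk; set g := lmul _ k; have [_ _ kf] := Kk.
have gf : g f = (a *: e + f) + w.
  rewrite /g !lmulE kf eich_f // (tvE hs) !E ef; case: hw => -> _.
  by rewrite addr0 mulr1 addrC addrA.
rewrite /heis; have -> : s (g f) f = a.
  by case: hw => _ fw; rewrite gf !E ef (sC0 hs fw) mulr1 !addr0.
have -> : pW s e f (g f) = w.
  rewrite gf pW_AW //; apply: (inAD hs); last exact: f_in.
  exact/(inAZ hs)/e_in.
congr (_ ** fW _); rewrite /g -[lmul (lmul _ _) k]lmulA.
rewrite [lmul (tv _ _ (- a)) _]lmulA -(tvD hs) addNr (tvx0 hs) lmul1 lmulA (lmulV hs) ?lmul1 //.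
exact: eich_Sp.
Qed.

Lemma heis_dec g : G1 s e g -> exists a w k,
  [/\ inW w, KW k & g = lmul (lmul (tv s e a) (eich w)) k].
Proof.
move=> [Sg ge]; pose a := s (g f) f; pose w := pW s e f (g f).
have hw : inW w by apply: (pW_in hs ef).
have Se := eich_Sp hw; have St := tv_Sp hs e a.
exists a, w, (lmul (linv (eich w)) (lmul (tv s e (- a)) g)).
have gf : g f = (a *: e + f) + w.
  rewrite -{1}(pAW s e f (g f)) pAE -/w -/a; congr (_ + _ + _).
  by rewrite -{1}ge (Sp_iso _ _ Sg) ef scale1r.
split=> //; last first.
  by rewrite -lmulA (lmulA (eich w)) (lmulVr hs Se) lmul1 -(tvV hs) lmulA (lmulVr hs St) lmul1.
split.
- by apply: (SpM hs); [exact: (SpV hs) | apply: (SpM hs) => //; apply: tv_Sp].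
- by rewrite !lmulE ge (tv_fix hs) ?(ss hs) // (linv_fix hs) // eich_e.
- rewrite !lmulE gf (tvE hs) !E ef; case: (hw) => -> _.
  have -> : a *: e + f + w + (- a * (a * 0 + 1 + 0)) *: e = eich w f.
    by rewrite eich_f // mulr0 add0r addr0 mulr1 scaleNr addrC !addrA addNr add0r.
  by rewrite (linvK hs).
Qed.

(** The product of two normal forms is brought to normal form by the Heisenberg law and the
    conjugation by [KW]. The images obey the same rules, by [nuD] and [nu_KW]. *)
Theorem heis_hom : hom_on (G1 s e) heis.
Proof.
move=> _ _ /heis_dec[a [w [k [hw Kk ->]]]] /heis_dec[a' [w' [k' [hw' Kk' ->]]]].
have [_ KM _] := KW_group hs e f; have hkw := KW_in Kk hw'.
have [Sk ke kf] := Kk.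
have -> : lmul (lmul (lmul (tv s e a) (eich w)) k) (lmul (lmul (tv s e a') (eich w')) k')
   = lmul (lmul (tv s e (a + a' + s w (k w'))) (eich (w + k w'))) (lmul k k').
  rewrite !(tvD hs) -!lmulA; congr lmul.
  rewrite (lmulA k) (tvJ' hs) // ke -lmulA (lmulA k) eich_KW // -!lmulA.
  rewrite (lmulA (eich w)) eich_comm_e // -lmulA; congr lmul.
  by rewrite !lmulA eichD.
rewrite !heisE //; [|exact: (inWD hs)|exact: KM].
have hnu := nuD hw hkw; rewrite nu_KW // in hnu.
have hz : fW k ** zeta a' = zeta a' ** fW k by rewrite /zeta comm_e.
have hz' := nu_zeta a' hw.
rewrite !zetaD homW // !agA; congr (_ ** _); rewrite -!agA.
rewrite (agA _ (zeta _) (nu _)) -hnu.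
rewrite (agA _ _ (zeta a')) (agA _ (fW k)) hz -!agA -hz' !agA; congr (_ ** (_ ** _)).
by rewrite /cj !agN.
Qed.
Lemma heis_KW k : KW k -> heis k = fW k.
Proof.
move=> Kk; rewrite -{1}[k]lmul1 -(lmul1 lone) -{1}(tvx0 hs e) -eich0 heisE //; last exact: inW0.
by rewrite zeta0 nu0 !ag_mul1.
Qed.

Lemma heis_tv m w a : inW w ->
  heis (tv s (m *: e + w) a) = zeta (m ^+ 2 * a) ** nu ((m * a) *: w) ** fW (tv s w a).
Proof.
by move=> hw; rewrite eich_tv // heisE //; [apply: (inWZ hs) | apply: (tv_KW hs)].
Qed.

Lemma heis_tv_e a : heis (tv s e a) = zeta a.
Proof.
have := heis_tv 1 a inW0; rewrite addr0 scale1r scaler0 nu0 ag1 expr1n mul1r => ->.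
by rewrite (tv0 hs) (hom1 (KW_group hs e f) homW) ag1.
Qed.

(** [X] stands for the image of an element of Sp(A) scaling [e] by [m]. Compatibility with the
    single element [eich e2] spreads to all of W because [X] commutes with the image of Sp(W). *)
Lemma heis_torus X m w a : (forall c, cj X (zeta c) = zeta (m ^+ 2 * c)) ->
  (forall k, KW k -> X ** fW k = fW k ** X) ->
  cj X (q (eich e2)) = q (eich (m *: e2)) -> inW w ->
  cj X (heis (tv s (e + w) a)) = heis (tv s (m *: e + w) a).
Proof.
move=> Xz XW Xe hw; have nuX v : inW v -> cj X (nu v) = nu (m *: v).
  move=> hv; have [->|v0] := eqVneq v 0; first by rewrite scaler0 nu0 cj1.
  have [k Kk ->] := nu_ex hv v0; have Be : inB (m *: e2) by apply: (inAZ hs); apply: e_in.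
  rewrite nuE // -cjMl XW // cjMl Xe -linearZ nu_KW //; last exact: inB_W.
  by rewrite nu_B.
rewrite -{1}(scale1r e) !heis_tv // expr1n !mul1r !cjM Xz nuX ?scalerA; last exact: (inWZ hs).
by congr (_ ** _); rewrite cj_commute // XW //; apply: (tv_KW hs).
Qed.

End Eichler.

(** * The slim subgroups *)

Section Slim.
Variables (F : fieldType) (V : vectType F) (s : V -> V -> F).
Variables (n : nat) (h : nat -> V).

(* Without the stabilization clauses of [S_pi] and [M_pi], which are automatic. *)
Definition slimS j (g : 'End(V)) := Sp s g /\ forall k, (k < n)%N -> k != j ->
  g (h (2 * k)%N) = h (2 * k)%N /\ g (h (2 * k).+1) = h (2 * k).+1.

Definition slimM i (g : 'End(V)) := [/\ Sp s g,
  (forall k, (k < n)%N -> g (h (2 * k)%N) = h (2 * k)%N) &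
  (forall k, (k < n)%N -> k != i -> k != i.+1 -> g (h (2 * k).+1) = h (2 * k).+1)].

Definition slim_gen (g : 'End(V)) :=
  (exists2 j, (j < n)%N & slimS j g) \/ (exists2 i, (i.+1 < n)%N & slimM i g).

(** Generators for the stabilizer of [h 0]: the first [S] subgroup is replaced by its transvections
    along [h 0]. *)
Definition slim_stab_gen (g : 'End(V)) :=
  [\/ (exists2 j, (0 < j < n)%N & slimS j g), (exists2 i, (i.+1 < n)%N & slimM i g)
    | exists a, g = tv s (h 0) a].

Definition slim_hom (H : abs_group) (f : 'End(V) -> H) :=
  (forall j, (j < n)%N -> hom_on (slimS j) f) /\
  [/\ forall i, (i.+1 < n)%N -> hom_on (slimM i) f,
      forall j l, (j < n)%N -> (l < n)%N -> j != l -> hom_on (gen2 (slimS j) (slimS l)) f,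
      forall i k, (i.+1 < n)%N -> (k.+1 < n)%N -> i != k -> hom_on (gen2 (slimM i) (slimM k)) f &
      forall i j, (i.+1 < n)%N -> (j < n)%N -> hom_on (gen2 (slimM i) (slimS j)) f].

Notation gen A := (gen_by (@lmul F V) lone (@linv F V) A).

Lemma gen_group (A : 'End(V) -> Prop) : group_pred (gen A).
Proof. by split; [exact: gen_one | exact: gen_mul | exact: gen_inv]. Qed.

Lemma gen_mono (A B : 'End(V) -> Prop) g : (forall x, A x -> B x) -> gen A g -> gen B g.
Proof.
move=> AB; elim=> [x /AB||x y _ hx _ hy|x _ hx]; [exact: gen_in | exact: gen_one | exact: gen_mul | exact: gen_inv].
Qed.

Lemma gen_le (A K : 'End(V) -> Prop) g : group_pred K -> (forall x, A x -> K x) -> gen A g -> K g.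
Proof. by move=> [K1 KM KV] AK; elim=> // *; auto. Qed.

Lemma gen2l (A B : 'End(V) -> Prop) g : A g -> gen2 A B g.
Proof. by move=> Ag; apply: gen_in; left. Qed.
Lemma gen2r (A B : 'End(V) -> Prop) g : B g -> gen2 A B g.
Proof. by move=> Ag; apply: gen_in; right. Qed.

Hypothesis hs : symplectic_form s.

Lemma gen2_Sp (A B : 'End(V) -> Prop) g : (forall x, A x -> Sp s x) -> (forall x, B x -> Sp s x) ->
  gen2 A B g -> Sp s g.
Proof. by move=> hA hB; apply: gen_le; [exact: Sp_group | move=> x [/hA|/hB]]. Qed.

Lemma slimS_Sp j g : slimS j g -> Sp s g. Proof. by case. Qed.
Lemma slimM_Sp i g : slimM i g -> Sp s g. Proof. by case. Qed.

Lemma slimM_group i : group_pred (slimM i).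
Proof.
have [S1 SM SV] := Sp_group hs; split.
- by split=> // *; rewrite !loneE.
- move=> g g' [Sg he hf] [Sg' he' hf']; split=> [|k kn|k kn ki ki1]; first exact: SM.
    by rewrite lmulE he' // he.
  by rewrite lmulE hf' // hf.
- move=> g [Sg he hf]; split=> [|k kn|k kn ki ki1]; first exact: SV.
    by apply: (linv_fix hs) => //; apply: he.
  by apply: (linv_fix hs) => //; apply: hf.
Qed.

Hypothesis sys : hyperbolic_system s n h.
Notation e_ j := (h (2 * j)%N).
Notation f_ j := (h (2 * j).+1).

Lemma perp_pair j v : (j < n)%N ->
  (forall k, (k < 2 * n)%N -> k./2 != j -> s (h k) v = 0) -> v = pA s (e_ j) (f_ j) v.
Proof.
move=> jn hv; have ef := pair_ef sys jn.
rewrite -{1}(pAW s (e_ j) (f_ j) v) -[RHS]addr0; congr (_ + _).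
have [ep fp] := pW_in hs ef v.
apply: (proj2 sys) => k kn; have [kj|kj] := eqVneq k./2 j; last first.
  rewrite pWE pAE !(sE hs) hv // !(pair0 hs sys) ?mulr0 ?addr0 ?subrr //; lia.
by have [->|->] : k = (2 * j)%N \/ k = (2 * j).+1 by lia.
Qed.

(** An isometry fixing the other basis vectors preserves their orthogonal, the plane of index [j];
    pairing with the basis then shows that it fixes the complement of that plane pointwise. *)
Lemma slimS_KA j g : (j < n)%N -> slimS j g <-> KA s (e_ j) (f_ j) g.
Proof.
move=> jn; have ef := pair_ef sys jn; split=> -[Sg hg]; split=> //.
- move=> w [ew fw]; have fixk k : (k < 2 * n)%N -> k./2 != j -> g (h k) = h k.
    move=> kn kj; have kn2 : (k./2 < n)%N by lia.
    have [a b] := hg k./2 kn2 kj.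
    have [kk|kk] : k = (2 * k./2)%N \/ k = (2 * k./2).+1 by lia.
      by rewrite kk a.
    by rewrite kk b.
  have gA k : (k < 2 * n)%N -> k./2 = j -> inA s (e_ j) (f_ j) (linv g (h k)).
    move=> kn kj; rewrite (@perp_pair j (linv g (h k))) //; first exact: (pA_in hs).
    move=> l ln lj; rewrite -(Sp_iso _ _ Sg) (linvVK hs) // fixk //.
    by apply: (pair0 hs sys) => //; rewrite kj.
  apply/eqP; rewrite -subr_eq0; apply/eqP; apply: (proj2 sys) => k kn.
  have [kj|kj] := eqVneq k./2 j; last first.
    by rewrite !(sE hs) -{1}(fixk k) // (Sp_iso _ _ Sg) subrr.
  have hk : s (h k) w = 0 by have [->|->] : k = (2 * j)%N \/ k = (2 * j).+1 by lia.
  by rewrite !(sE hs) hk subr0 -(linvVK hs (h k) Sg) (Sp_iso _ _ Sg); apply: gA.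
- by move=> k kn kj; split; apply: hg; split; apply: (pair0 hs sys); lia.
Qed.

Lemma pA_span j v : pA s (e_ j) (f_ j) v \in <<[:: e_ j; f_ j]>>%VS.
Proof. by rewrite pAE; apply: memvD; apply: memvZ; apply: memv_span; rewrite !inE eqxx ?orbT. Qed.

Lemma img_span_eq g (X : seq V) : Sp s g -> (forall x, x \in X -> g x \in <<X>>%VS) ->
  (g @: <<X>> = <<X>>)%VS.
Proof.
move=> Sg hg; apply/eqP; rewrite eqEdim limg_dim_eq ?leqnn; last first.
  by rewrite (eqP (Sp_ker hs Sg)) capv0.
by rewrite andbT limg_span; apply/span_subvP => _ /mapP[x xX ->]; apply: hg.
Qed.

Lemma S_pi_slim j g : (j < n)%N -> S_pi s n h j g <-> slimS j g.
Proof.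
move=> jn; split=> [[Sg hg _]|[Sg hg]]; first by split.
split=> //; apply: img_span_eq => // x hx.
have [_ hg'] : KA s (e_ j) (f_ j) g by apply/slimS_KA.
have hA : inA s (e_ j) (f_ j) x.
  by move: hx; rewrite !inE => /orP[] /eqP-> w [].
rewrite -(pA_A hs (pair_ef sys jn) (KA_in (conj Sg hg') hA)); exact: pA_span.
Qed.

Lemma M_pi_slim i g : (i.+1 < n)%N -> M_pi s n h i g <-> slimM i g.
Proof.
move=> jn; split=> [[Sg he hf _]|[Sg he hf]]; first by split.
split=> //; apply: img_span_eq => // x hx.
have fixk k : (k < 2 * n)%N -> k./2 != i -> k./2 != i.+1 -> g (h k) = h k.
  move=> kn ki ki1; have [kk|kk] : k = (2 * k./2)%N \/ k = (2 * k./2).+1 by lia.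
    by rewrite kk; apply: he; lia.
  by rewrite kk; apply: hf => //; lia.
have perp k : (k < 2 * n)%N -> k./2 != i -> k./2 != i.+1 -> s (h k) (g x) = 0.
  move=> kn ki ki1; rewrite -(fixk k) // (Sp_iso _ _ Sg).
  by move: hx; rewrite !inE => /or4P[] /eqP->; apply: (pair0 hs sys); lia.
have [i0 i1] : (i < n)%N /\ (i.+1 < n)%N by lia.
have ef := pair_ef sys i0; have [ep fp] := pW_in hs ef (g x).
have e2 : pW s (e_ i) (f_ i) (g x) = pA s (e_ i.+1) (f_ i.+1) (pW s (e_ i) (f_ i) (g x)).
  apply: perp_pair => // k kn ki1; have [ki|ki] := eqVneq k./2 i.
    by have [->|->] : k = (2 * i)%N \/ k = (2 * i).+1 by lia.
  rewrite pWE pAE !(sE hs) perp // !(pair0 hs sys) ?mulr0 ?addr0 ?subrr //; lia.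
rewrite -(pAW s (e_ i) (f_ i) (g x)) e2.
apply: memvD; [have := pA_span i (g x) | have := pA_span i.+1 (pW s (e_ i) (f_ i) (g x))];
apply/subvP; apply: sub_span => y; rewrite !inE; case/orP=> ->; rewrite ?orbT //.
Qed.

End Slim.

(** * Restriction to the complement of a hyperbolic plane *)

Section Restriction.
Variables (F : fieldType) (V : vectType F) (s : V -> V -> F).
Hypothesis hs : symplectic_form s.
Variables (e f : V).
Hypothesis ef : s e f = 1.
Notation inW := (inW s e f).
Notation KW := (KW s e f).
Notation pA := (pA s e f).
Notation pW := (pW s e f).

(** A subspace is needed, and not only the predicate [inW], so that [subvs_of] gives a [vectType] on
    which the induction can run. *)
Definition Wsp : {vspace V} := lker (linfun pA).

Lemma memW w : inW w <-> w \in Wsp.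
Proof.
rewrite memv_ker linear_lfun => [|c u v]; last by rewrite (pAD hs) (pAZ hs).
split=> [/(pA_W hs)->|/eqP pw]; first exact: eqxx.
by rewrite -(pAW s e f w) pw add0r; apply: (pW_in hs ef).
Qed.

Notation W := (subvs_of Wsp).

Definition subform (x y : W) := s (vsval x) (vsval y).

Lemma val_inW (x : W) : inW (vsval x). Proof. by apply/memW/subvsP. Qed.

Lemma projK w : inW w -> vsval (vsproj Wsp w) = w. Proof. by move=> hw; apply/vsprojK/memW. Qed.

Lemma subform_symplectic : symplectic_form subform.
Proof.
split.
- by move=> a u v w; rewrite /subform linearP !(sE hs).
- by move=> a u v w; rewrite /subform linearP !(sE hs).
- by move=> v; apply: (ss hs).
- move=> u hu; apply: subvs_inj; rewrite linear0; apply: (s_inj hs) => z.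
  rewrite (s0r hs) -(pAW s e f z) (sDl hs) (pA_in hs) ?add0r; last exact: val_inW.
  by rewrite -(projK (pW_in hs ef z)); apply: (sC0 hs); apply: hu.
Qed.

Lemma pA_lin c u v : pA (c *: u + v) = c *: pA u + pA v.
Proof. by rewrite (pAD hs) (pAZ hs). Qed.
Lemma pW_lin c u v : pW (c *: u + v) = c *: pW u + pW v.
Proof. by rewrite (pWD hs) (pWZ hs). Qed.

Definition ext (g : 'End(W)) : 'End(V) :=
  linfun (fun v => pA v + vsval (g (vsproj Wsp (pW v)))).
Definition res (g : 'End(V)) : 'End(W) := linfun (fun x => vsproj Wsp (g (vsval x))).

Lemma extE g v : ext g v = pA v + vsval (g (vsproj Wsp (pW v))).
Proof.
rewrite linear_lfun // => c u w.
by rewrite pA_lin pW_lin !linearP scalerDr addrACA.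
Qed.

Lemma ext_val g x : ext g (vsval x) = vsval (g x).
Proof. by rewrite extE (pA_W hs (val_inW x)) add0r (pW_W hs (val_inW x)) vsvalK. Qed.

Lemma ext_inA g x : inA s e f x -> ext g x = x.
Proof. by move=> hx; rewrite extE (pA_A hs ef hx) (pW_A hs ef hx) !linear0 addr0. Qed.

Lemma resE g x : KW g -> vsval (res g x) = g (vsval x).
Proof.
move=> Kg; rewrite linear_lfun => [|c u v]; last by rewrite !linearP.
by apply: projK; apply: (KW_in Kg); apply: val_inW.
Qed.

Lemma ext_KW g : Sp subform g -> KW (ext g).
Proof.
move=> Sg; split; [|exact/ext_inA/e_in|exact/ext_inA/f_in].
apply: (SpP hs) => u v; rewrite !extE (s_split hs ef) [RHS](s_split hs ef).
rewrite !(pA_AW hs ef (pA_in hs _) (val_inW _)) !(pW_AW hs ef (pA_in hs _) (val_inW _)).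
by congr (_ + _); rewrite -/(subform _ _) (Sp_iso _ _ Sg) /subform !projK //; apply: (pW_in hs ef).
Qed.

Lemma res_Sp g : KW g -> Sp subform (res g).
Proof.
move=> Kg; apply: (SpP subform_symplectic) => x y.
by rewrite /subform !resE //; case: Kg => Sg _ _; rewrite (Sp_iso _ _ Sg).
Qed.

Lemma ext_res g : KW g -> ext (res g) = g.
Proof.
move=> Kg; apply/lfunP => v; rewrite extE resE // projK; last exact: (pW_in hs ef).
by rewrite -(KW_act hs ef).
Qed.

Lemma extM g k : ext (lmul g k) = lmul (ext g) (ext k).
Proof.
apply/lfunP => v; rewrite lmulE (extE k) linearD /= (ext_inA _ (pA_in hs v)).
by rewrite ext_val extE lmulE.
Qed.

Lemma ext1 : ext lone = lone.
Proof.
by apply/lfunP => v; rewrite extE !loneE projK ?pAW //; apply: (pW_in hs ef).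
Qed.

Lemma extV g : Sp subform g -> ext (linv g) = linv (ext g).
Proof.
move=> Sg; have [Sx _ _] := ext_KW Sg.
rewrite -[LHS]lmul1 -(lmulV hs Sx) -lmulA -extM (lmulVr subform_symplectic) //.
by rewrite ext1 lmulr1.
Qed.

Lemma resM g k : KW g -> KW k -> res (lmul g k) = lmul (res g) (res k).
Proof.
move=> Kg Kk; have [_ KM _] := KW_group hs e f.
apply/lfunP => x; apply: subvs_inj; rewrite lmulE resE ?lmulE; last exact: KM.
by rewrite !resE.
Qed.

Lemma gen_ext (A : 'End(W) -> Prop) (B : 'End(V) -> Prop) g :
  (forall x, A x -> Sp subform x /\ B (ext x)) ->
  gen_by (@lmul F W) lone (@linv F W) A g -> gen_by (@lmul F V) lone (@linv F V) B (ext g).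
Proof.
move=> AB Ag; suff [] : Sp subform g /\ gen_by (@lmul F V) lone (@linv F V) B (ext g) by [].
have [S1 SM SV] := Sp_group subform_symplectic.
elim: Ag => [x /AB[Sx Bx]||x y _ [Sx hx] _ [Sy hy]|x _ [Sx hx]].
- by split=> //; apply: gen_in.
- by rewrite ext1; split=> //; apply: gen_one.
- by split; [exact: SM | rewrite extM; apply: gen_mul].
- by split; [exact: SV | rewrite extV //; apply: gen_inv].
Qed.

Lemma ext_tv w a : inW w -> ext (tv subform (vsproj Wsp w) a) = tv s w a.
Proof.
move=> hw; apply/lfunP => v; rewrite extE (tvE subform_symplectic) (tvE hs).
rewrite linearD linearZ /= /subform !projK //; last exact: (pW_in hs ef).
rewrite addrA pAW (s_split hs ef w v) (pA_W hs hw) (s0l hs) add0r.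
by rewrite (pW_W hs hw).
Qed.

Section System.
Variables (n : nat) (h : nat -> V).
Hypotheses (he : e = h 0) (hf : f = h 1) (sys : hyperbolic_system s n.+1 h).

Definition subbasis k : W := vsproj Wsp (h k.+2).

Lemma hW k : (k < 2 * n)%N -> inW (h k.+2).
Proof. by move=> kn; split; rewrite ?he ?hf; apply: (pair0 hs sys); lia. Qed.

Lemma subbasisK k : (k < 2 * n)%N -> vsval (subbasis k) = h k.+2.
Proof. by move=> kn; apply: projK; apply: hW. Qed.

Lemma sub_system : hyperbolic_system subform n subbasis.
Proof.
split=> [i j hi hj|v hv].
  have [a b c] := proj1 sys i.+1 j.+1 hi hj; rewrite !mulnS /= in a b c.
  by rewrite /subform !subbasisK ?a ?b ?c; [split | lia..].
apply: subvs_inj; rewrite linear0; apply: (proj2 sys) => -[|[|k]] kn.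
- by rewrite -he; case: (val_inW v).
- by rewrite -hf; case: (val_inW v).
- have kn' : (k < 2 * n)%N by lia.
  by rewrite -subbasisK //; apply: hv.
Qed.

Lemma ext_fix (g : 'End(W)) k : (k < 2 * n)%N -> g (subbasis k) = subbasis k -> ext g (h k.+2) = h k.+2.
Proof. by move=> kn gk; rewrite -subbasisK // ext_val gk. Qed.

Lemma res_fix (g : 'End(V)) k : (k < 2 * n)%N -> KW g -> g (h k.+2) = h k.+2 -> res g (subbasis k) = subbasis k.
Proof. by move=> kn Kg gk; apply: subvs_inj; rewrite resE // subbasisK. Qed.

Lemma ext_slimS j g : slimS subform n subbasis j g -> slimS s n.+1 h j.+1 (ext g).
Proof.
case=> Sg hg; have [Sx ee ff] := ext_KW Sg; split=> // -[|k] kn kj.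
  by rewrite -[h (2 * 0)]he -[h (2 * 0).+1]hf.
have [] := hg k kn kj.
by rewrite !mulnS /=; split; apply: ext_fix => //; lia.
Qed.

Lemma ext_slimM i g : slimM subform n subbasis i g -> slimM s n.+1 h i.+1 (ext g).
Proof.
case=> Sg hg hg'; have [Sx ee ff] := ext_KW Sg; split=> // -[|k] kn.
- by rewrite -[h (2 * 0)]he.
- by have := hg k kn; rewrite !mulnS /= => ?; apply: ext_fix => //; lia.
- by move=> _ _; rewrite -[h (2 * 0).+1]hf.
- by move=> ki ki1; have := hg' k kn ki ki1; rewrite !mulnS /= => ?; apply: ext_fix => //; lia.
Qed.

Lemma slimS_KW j g : slimS s n.+1 h j.+1 g -> KW g.
Proof. by case=> Sg hg; have [] := hg 0; rewrite // he hf; split. Qed.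

Lemma slimM_KW i g : slimM s n.+1 h i.+1 g -> KW g.
Proof.
case=> Sg hg hg'; split=> //; first by rewrite he; apply: (hg 0).
by rewrite hf; apply: (hg' 0).
Qed.

Lemma res_slimS j g : slimS s n.+1 h j.+1 g -> slimS subform n subbasis j (res g).
Proof.
move=> hS; have Kg := slimS_KW hS; split; first exact: res_Sp.
move=> k kn kj; have [_ hg] := hS; have [] := hg k.+1 kn kj.
by rewrite !mulnS /= => ? ?; split; apply: res_fix => //; lia.
Qed.

Lemma res_slimM i g : slimM s n.+1 h i.+1 g -> slimM subform n subbasis i (res g).
Proof.
move=> hM; have Kg := slimM_KW hM; have [_ hg hg'] := hM; split; first exact: res_Sp.
  by move=> k kn; have := hg k.+1 kn; rewrite !mulnS /= => ?; apply: res_fix => //; lia.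
by move=> k kn ki ki1; have := hg' k.+1 kn ki ki1; rewrite !mulnS /= => ?; apply: res_fix => //; lia.
Qed.

Lemma ext_slim_hom (H : abs_group) (f0 : 'End(V) -> H) :
  slim_hom s n.+1 h f0 -> slim_hom subform n subbasis (fun g => f0 (ext g)).
Proof.
have hS := @slimS_Sp _ W subform n subbasis; have hM := @slimM_Sp _ W subform n subbasis.
case=> hS' [hM' hSS hMM hMS]; do !split.
- by move=> j jn g k hg hk; rewrite extM; apply: (hS' j.+1) => //; apply: ext_slimS.
- by move=> j jn g k hg hk; rewrite extM; apply: (hM' j.+1) => //; apply: ext_slimM.
- move=> j l jn ln jl g k hg hk; rewrite extM; apply: (hSS j.+1 l.+1) => //;
  [move: hg | move: hk]; apply: gen_ext => x [hx|hx]; split; first [exact: hS hx | left; exact: ext_slimS | right; exact: ext_slimS].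
- move=> j l jn ln jl g k hg hk; rewrite extM; apply: (hMM j.+1 l.+1) => //;
  [move: hg | move: hk]; apply: gen_ext => x [hx|hx]; split; first [exact: hM hx | left; exact: ext_slimM | right; exact: ext_slimM].
- move=> j l jn ln g k hg hk; rewrite extM; apply: (hMS j.+1 l.+1) => //;
  [move: hg | move: hk]; apply: gen_ext => x [hx|hx]; split; first [exact: hM hx | exact: hS hx | left; exact: ext_slimM | right; exact: ext_slimS].
Qed.

End System.
End Restriction.

(** * The inductive step *)

Section Step.
Variables (F : fieldType) (V : vectType F) (s : V -> V -> F).
Hypothesis hs : symplectic_form s.
Variables (n : nat) (h : nat -> V).
Hypotheses (n0 : (0 < n)%N) (sys : hyperbolic_system s n.+1 h).
Notation e := (h 0).
Notation f := (h 1).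
Notation e2 := (h 2).
Notation f2 := (h 3).
Let E := (sE hs).

Lemma ef01 : s e f = 1. Proof. exact: (pair_ef sys (i := 0)). Qed.
Lemma ef23 : s e2 f2 = 1. Proof. exact: (pair_ef sys (i := 1)). Qed.

Notation W := (subvs_of (Wsp s e f)).
Notation s' := (@subform F V s e f).
Notation h' := (subbasis s e f h).
Let hs' := subform_symplectic hs ef01.
Let sys' : hyperbolic_system s' n h' := sub_system hs ef01 erefl erefl sys.
Let ef := ef01.
Let ef2 := ef23.

Hypothesis gen_sub : forall g, Sp s' g -> gen_by (@lmul F W) lone (@linv F W) (slim_gen s' n h') g.
Hypothesis stab_sub : forall g, Sp s' g -> g (h' 0) = h' 0 ->
  gen_by (@lmul F W) lone (@linv F W) (slim_stab_gen s' n h') g.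

Notation gen A := (gen_by (@lmul F V) lone (@linv F V) A).

Lemma e2W : inW s e f e2. Proof. by apply: (hW hs erefl erefl sys (k := 0)); lia. Qed.
Lemma f2W : inW s e f f2. Proof. by apply: (hW hs erefl erefl sys (k := 1)); lia. Qed.

Lemma KA_S0 g : KA s e f g <-> slimS s n.+1 h 0 g.
Proof. by apply: iff_sym; apply: (slimS_KA hs sys (j := 0)). Qed.

Lemma KA_S1 g : KA s e2 f2 g <-> slimS s n.+1 h 1 g.
Proof. by apply: iff_sym; apply: (slimS_KA hs sys (j := 1)). Qed.

(** With [slimM0_eich], this shows that the first [M] subgroup contains a short root group and the
    long root groups of [e] and [e2]. *)
Lemma slimM0_tv m c a : slimM s n.+1 h 0 (tv s (m *: e + c *: e2) a).
Proof.
split; first exact: tv_Sp.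
- move=> k kn; rewrite tv_fix // !E -[e]/(h (2 * 0)) -[e2]/(h (2 * 1)).
  by rewrite !(pair_ee sys) // !mulr0 addr0.
- move=> k kn k0 k1; rewrite tv_fix // !E !(pair0 hs sys) ?mulr0 ?addr0 //; lia.
Qed.

Lemma slimM0_eich m : slimM s n.+1 h 0 (eich s e (m *: e2)).
Proof.
split; first by apply: (eich_Sp hs (f := f)); apply: (inWZ hs); apply: e2W.
- move=> k kn; rewrite (eichE hs) !E -[e]/(h (2 * 0)) -[e2]/(h (2 * 1)).
  by rewrite !(pair_ee sys) // mulr0 !scale0r !addr0.
- move=> k kn k0 k1; rewrite (eichE hs) !E !(pair0 hs sys) ?mulr0 ?scale0r ?addr0 //; lia.
Qed.

Definition inner_gen (g : 'End(V)) :=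
  (exists2 j, (j < n)%N & slimS s n.+1 h j.+1 g) \/ (exists2 i, (i.+1 < n)%N & slimM s n.+1 h i.+1 g).

Lemma slim_gen_Sp g : slim_gen s' n h' g -> Sp s' g.
Proof. by case=> [[j _ []]|[i _ []]]. Qed.

Lemma KW_gen g : KW s e f g -> gen inner_gen g.
Proof.
move=> Kg; rewrite -(ext_res hs ef Kg).
apply: (gen_ext hs ef _ (gen_sub (res_Sp hs ef Kg))) => x hx.
split; first exact: slim_gen_Sp.
case: hx => [[j jn hj]|[i im hi]]; [left; exists j | right; exists i] => //.
  exact: (ext_slimS hs ef erefl erefl sys).
exact: (ext_slimM hs ef erefl erefl sys).
Qed.

Lemma split_W x : pW s e f x != 0 -> exists2 k, KW s e f k & x = k (pA s e f x + e2).
Proof.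
move=> x0; have [k [Kk ke]] := KW_trans hs ef e2W (pW_in hs ef x) (e_neq0 hs ef2) x0.
by exists k => //; rewrite linearD /= ke (KW_A hs ef Kk) ?(pAW s e f) //; apply: (pA_in hs).
Qed.

(** A transvection lies in [KA] or [KW], or is conjugate under both to one along [e + e2], which
    belongs to the first [M]. *)
Lemma step_gen g : Sp s g -> gen (slim_gen s n.+1 h) g.
Proof.
move/(Sp_TG hs); have [G1 GM GV] := gen_group (V := V) (slim_gen s n.+1 h).
have inner x : gen inner_gen x -> gen (slim_gen s n.+1 h) x.
  by apply: gen_mono => {}x [[j jn hj]|[i im hi]]; [left; exists j.+1 | right; exists i.+1].
have KAg x : KA s e f x -> gen (slim_gen s n.+1 h) x.
  by move/KA_S0 => hx; apply: gen_in; left; exists 0.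
apply: TG_ind => [|x a _]; first by split.
have [w0|w0] := eqVneq (pW s e f x) 0.
  by apply/KAg/(tv_KA hs); rewrite -(pAW s e f x) w0 addr0; apply: (pA_in hs).
have [k Kk xk] := split_W w0.
have [p0|p0] := eqVneq (pA s e f x) 0.
  by apply/inner/KW_gen/(tv_KW hs)/(pA0_inW hs ef).
have [g0 [Kg ge]] := KA_trans hs ef (@pA_in _ _ _ hs e f x) p0.
have -> : x = k (g0 (e + e2)) by rewrite linearD /= ge (proj2 Kg _ e2W) -xk.
rewrite -!(tvJ hs); [|by case: Kg|by case: Kk].
have hk := inner _ (KW_gen Kk); have hg := KAg _ Kg.
have h0 : gen (slim_gen s n.+1 h) (tv s (e + e2) a).
  apply: gen_in; right; exists 0; first lia.
  by have := slimM0_tv 1 1 a; rewrite !scale1r.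
by apply: (GM _ _ (GM _ _ hk (GM _ _ (GM _ _ hg h0) (GV _ hg))) (GV _ hk)).
Qed.

(** The stabilizer of [e] is generated by transvections orthogonal to [e]. Each is along [e], or is
    conjugate under [KW] to one along a multiple of [e] plus [e2], hence in the first [M]. *)
Lemma step_stab g : Sp s g -> g e = e -> gen (slim_stab_gen s n.+1 h) g.
Proof.
move=> Sg ge; have := perp_TG hs Sg ge.
have [G1 GM GV] := gen_group (V := V) (slim_stab_gen s n.+1 h).
have inner x : gen inner_gen x -> gen (slim_stab_gen s n.+1 h) x.
  apply: gen_mono => {}x [[j jn hj]|[i im hi]]; first by constructor 1; exists j.+1.
  by constructor 2; exists i.+1.
apply: TG_ind => [|x a ex]; first by split.
have px : pA s e f x = s x f *: e by rewrite pAE ex scale0r addr0.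
have [w0|w0] := eqVneq (pW s e f x) 0.
  apply: gen_in; constructor 3; exists (s x f ^+ 2 * a).
  by rewrite -(tvZ hs) -px -{1}(pAW s e f x) w0 addr0.
have [k Kk xk] := split_W w0; have hk := inner _ (KW_gen Kk).
rewrite {1}xk -(tvJ hs); last by case: Kk.
apply: (GM); last exact: GV.
apply: GM => //; apply: gen_in; constructor 2; exists 0; first lia.
by have := slimM0_tv (s x f) 1 a; rewrite scale1r px.
Qed.

(** * Extending the homomorphism from Sp(W) to Sp(V) *)

Section Ext.
Hypothesis big : exists z : F, z != 0 /\ z != 1.
Variables (H : abs_group) (f0 : 'End(V) -> H) (phi' : 'End(W) -> H).
Hypotheses (f0_hom : slim_hom s n.+1 h f0) (phi'_hom : hom_on (Sp s') phi')
  (phi'E : forall g, slim_gen s' n h' g -> phi' g = f0 (ext g)).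

Let fW g := phi' (res s e f g).

Lemma fW_hom : hom_on (KW s e f) fW.
Proof.
by move=> g k Kg Kk; rewrite /fW (resM hs ef) // phi'_hom //; apply: (res_Sp hs ef).
Qed.

Lemma fW_S j g : (j < n)%N -> slimS s n.+1 h j.+1 g -> fW g = f0 g.
Proof.
move=> jn hg; have Kg := slimS_KW (e := e) (f := f) erefl erefl hg.
rewrite /fW phi'E ?(ext_res hs ef) //.
by left; exists j => //; apply: (res_slimS hs ef erefl erefl sys).
Qed.

Lemma fW_M i g : (i.+1 < n)%N -> slimM s n.+1 h i.+1 g -> fW g = f0 g.
Proof.
move=> jn hg; have Kg := slimM_KW (e := e) (f := f) erefl erefl hg.
rewrite /fW phi'E ?(ext_res hs ef) //.
by right; exists i => //; apply: (res_slimM hs ef erefl erefl sys).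
Qed.

Lemma comm_gen x (A : 'End(W) -> Prop) g :
  (forall k, A k -> Sp s' k /\ x ** phi' k = phi' k ** x) ->
  gen_by (@lmul F W) lone (@linv F W) A g -> x ** phi' g = phi' g ** x.
Proof.
move=> hA hg; have [S1 SM SV] := Sp_group hs'.
suff [] : Sp s' g /\ x ** phi' g = phi' g ** x by [].
elim: hg => [k /hA//||k l _ [Sk hk] _ [Sl hl]|k _ [Sk hk]].
- by split=> //; rewrite (hom1 (Sp_group hs') phi'_hom) ag1 ag_mul1.
- by split; [exact: SM | rewrite phi'_hom // ag_mulA hk agA hl ag_mulA].
- split; [exact: SV | rewrite (homV hs' _ (Sp_group hs') phi'_hom) //].
  by apply: (@agI _ (phi' k)); rewrite !ag_mulA agV ag_mul1 -hk !agN.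
Qed.

Lemma comm_of (K : 'End(V) -> Prop) g k : hom_on K f0 -> K g -> K k ->
  lmul g k = lmul k g -> f0 g ** f0 k = f0 k ** f0 g.
Proof. by move=> hK Kg Kk e0; rewrite -!hK // e0. Qed.

(** It suffices to let [k] be a slim generator of Sp(W); it then lies with the first [S] in a common
    rank two member of the amalgam, where commutation in Sp(V) can be transferred. *)
Lemma comm_KA_KW g k : KA s e f g -> KW s e f k -> f0 g ** fW k = fW k ** f0 g.
Proof.
have [hS [hM hSS hMM hMS]] := f0_hom.
move=> Kg Kk; apply: comm_gen (gen_sub (res_Sp hs ef Kk)) => x hx.
have Sx := slim_gen_Sp hx; split=> //; rewrite phi'E //.
have cx := KA_KW_commute hs ef Kg (ext_KW hs ef Sx).
have Sg : slimS s n.+1 h 0 g by apply/KA_S0.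
case: hx => [[j jn hj]|[i im hi]].
- apply: (comm_of (hSS 0 j.+1 _ _ _)) => //; [exact: gen2l | apply: gen2r].
  exact: (ext_slimS hs ef erefl erefl sys).
- apply: (comm_of (hMS i.+1 0 _ _)) => //; [exact: gen2r | apply: gen2l].
  exact: (ext_slimM hs ef erefl erefl sys).
Qed.

(** Here the generation of the stabilizer of [e2] in Sp(W) is used: each generator lies with the
    first [M] in one member of the amalgam, and transvections along [e2] lie in that [M] itself. *)
Lemma comm_eich_KW k : KW s e f k -> k e2 = e2 ->
  f0 (eich s e e2) ** fW k = fW k ** f0 (eich s e e2).
Proof.
have [hS [hM hSS hMM hMS]] := f0_hom.
have Me : slimM s n.+1 h 0 (eich s e e2) by have := slimM0_eich 1; rewrite scale1r.
move=> Kk ke.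
have fixe : res s e f k (h' 0) = h' 0.
  by apply: (res_fix hs ef erefl erefl sys) => //; lia.
apply: comm_gen (stab_sub (res_Sp hs ef Kk) fixe) => x hx.
have cm y : KW s e f y -> y e2 = e2 -> lmul (eich s e e2) y = lmul y (eich s e e2).
  by move=> Ky ye; rewrite (eich_KW hs e2 Ky) ye.
case: hx => [[j jn hj]|[i im hi]|[a ->]].
- have Sx := slimS_Sp hj; split=> //; rewrite phi'E; last by left; exists j => //; lia.
  have hy := ext_slimS hs ef erefl erefl sys hj.
  apply: (comm_of (hMS 0 j.+1 _ _)); [lia | lia | exact: gen2l | exact: gen2r |].
  apply: cm; first exact: (slimS_KW erefl erefl hy).
  by have [||e0 _] := proj2 hy 1; [lia | lia | exact: e0].
- have Sx := slimM_Sp hi; split=> //; rewrite phi'E; last by right; exists i.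
  have hy := ext_slimM hs ef erefl erefl sys hi.
  apply: (comm_of (hMM 0 i.+1 _ _ _)); [lia | lia | lia | exact: gen2l | exact: gen2r |].
  apply: cm; first exact: (slimM_KW erefl erefl hy).
  by case: hy => _ /(_ 1) h1 _; apply: h1; lia.
- split; first exact: (tv_Sp hs').
  rewrite phi'E; last first.
    left; exists 0 => //; apply/(slimS_KA hs' sys' _ n0)/(tv_KA hs')/e_in.
  rewrite (ext_tv hs ef a e2W); apply: (comm_of (hM 0 _)) => //.
    by have := slimM0_tv 0 1 a; rewrite scale0r scale1r add0r.
  apply: cm; first by apply/(tv_KW hs)/e2W.
  by rewrite (tv_fix hs) // E.
Qed.

(** Conjugating the short root group of the first [M] by the second [S] gives all Eichler elements
    of the plane of [e2] and [f2], so the Heisenberg construction can start in this one member. *)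
Let Q := gen2 (slimM s n.+1 h 0) (slimS s n.+1 h 1).

Lemma Q_Sp g : Q g -> Sp s g.
Proof. by apply: (gen2_Sp hs); [exact: slimM_Sp | exact: slimS_Sp]. Qed.

Lemma Q_hom : hom_on Q f0.
Proof. by have [_ [_ _ _ hMS]] := f0_hom; apply: hMS; lia. Qed.

Lemma Q_group : group_pred Q. Proof. exact: gen_group. Qed.

Lemma Q_eich w : inA s e2 f2 w -> Q (eich s e w).
Proof.
have [_ QM QV] := Q_group; move=> hw.
have [->|w0] := eqVneq w 0; first by rewrite (eich0 hs); apply: gen_one.
have [k [Kk <-]] := KA_trans hs ef2 hw w0.
have Qk : Q k by apply/gen2r/KA_S1.
rewrite -(eichJ_KW hs e2 (KB_KW hs e2W f2W Kk)).
apply: (QM _ _ (QM _ _ Qk _) (QV _ Qk)); apply: gen2l.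
by have := slimM0_eich 1; rewrite scale1r.
Qed.

Lemma Q_tv a : Q (tv s e a).
Proof. by apply: gen2l; have := slimM0_tv 1 0 a; rewrite scale0r scale1r addr0. Qed.

Lemma Q_KB g : KA s e2 f2 g -> Q g /\ f0 g = fW g.
Proof. by move/KA_S1 => hg; split; [exact: gen2r | rewrite (@fW_S 0)]. Qed.

Lemma comm_tv_KW a k : KW s e f k -> f0 (tv s e a) ** fW k = fW k ** f0 (tv s e a).
Proof. by apply: comm_KA_KW; apply/(tv_KA hs)/e_in. Qed.

Let f1 := heis s e f e2 fW f0.

Lemma f1_hom : hom_on (G1 s e) f1.
Proof.
exact: (heis_hom hs ef ef2 e2W f2W big fW_hom Q_Sp Q_group Q_hom Q_eich Q_tv Q_KB comm_tv_KW comm_eich_KW).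
Qed.

(** All three factors given by [eich_tv] lie in the first [M], and [f1] agrees with [f0] on each. *)
Lemma f1_M0 m c a : f1 (tv s (m *: e + c *: e2) a) = f0 (tv s (m *: e + c *: e2) a).
Proof.
have hc : inW s e f (c *: e2) by apply: (inWZ hs); apply: e2W.
have hB b : inA s e2 f2 (b *: e2) by apply: (inAZ hs); apply: e_in.
rewrite /f1 (heis_tv hs ef e2 fW f0 m a hc) scalerA /zeta.
rewrite (nu_B hs ef ef2 e2W f2W fW_hom Q_Sp Q_group Q_hom Q_eich Q_KB comm_eich_KW) //.
have [_ <-] := Q_KB (tv_KA hs a (hB c)).
have [_ [hM _ _ _]] := f0_hom; have hM0 := hM 0 (ltac:(lia)).
have t0 b d : slimM s n.+1 h 0 (tv s (b *: e2) d).
  by have := slimM0_tv 0 b d; rewrite scale0r add0r.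
have t1 d : slimM s n.+1 h 0 (tv s e d).
  by have := slimM0_tv 1 0 d; rewrite scale1r scale0r addr0.
have [_ MM _] := slimM_group n.+1 h hs 0.
have t2 := slimM0_eich (m * a * c).
by rewrite (eich_tv hs m a hc) scalerA !hM0 //; apply: MM.
Qed.

Lemma f1_KW k : KW s e f k -> f1 k = fW k.
Proof. exact: (heis_KW hs ef e2 fW Q_hom Q_tv). Qed.

Lemma KA_hom : hom_on (KA s e f) f0.
Proof. by have [hS _] := f0_hom; move=> g k /KA_S0 ? /KA_S0 ?; apply: (hS 0). Qed.

Lemma f0_torus g m w a : KA s e f g -> g e = m *: e -> inW s e f w ->
  cj (f0 g) (f1 (tv s (e + w) a)) = f1 (tv s (m *: e + w) a).
Proof.
move=> Kg ge hw; have [Sg gW] := Kg.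
apply: (heis_torus hs ef ef2 e2W f2W fW_hom Q_Sp Q_group Q_hom Q_eich Q_KB comm_eich_KW) => //.
- move=> c; rewrite /zeta -(homJ hs (fun g h => proj1 h) (KA_group hs e f) KA_hom) //.
    by rewrite (tvJ hs) // ge (tvZ hs).
  exact/(tv_KA hs)/e_in.
- by move=> k; apply: comm_KA_KW.
- have [_ [_ _ _ hMS]] := f0_hom; have homQ0 := hMS 0 0 (ltac:(lia)) (ltac:(lia)).
  have QS g' : gen2 (slimM s n.+1 h 0) (slimS s n.+1 h 0) g' -> Sp s g'.
    by apply: (gen2_Sp hs); [exact: slimM_Sp | exact: slimS_Sp].
  rewrite -(homJ hs QS (gen_group _) homQ0); last 2 first.
  + by apply/gen2r/KA_S0.
  + by apply: gen2l; have := slimM0_eich 1; rewrite scale1r.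
  by rewrite (eichJ hs Sg ge (gW _ e2W)).
Qed.

Lemma f0_agree_e a : f0 (tv s e a) = f1 (tv s e a).
Proof. by rewrite /f1 (heis_tv_e hs ef e2 f0 fW_hom). Qed.

Lemma f0_f1_comm g k : KA s e f g -> KW s e f k -> f0 g ** f1 k = f1 k ** f0 g.
Proof. by move=> Kg Kk; rewrite f1_KW //; apply: comm_KA_KW. Qed.

Let T := tau s e f f0 f1.
Let P := gen2 (slimM s n.+1 h 0) (slimS s n.+1 h 0).

Lemma P_Sp g : P g -> Sp s g.
Proof. by apply: (gen2_Sp hs); [exact: slimM_Sp | exact: slimS_Sp]. Qed.

Lemma P_hom : hom_on P f0.
Proof. by have [_ [_ _ _ hMS]] := f0_hom; apply: hMS; lia. Qed.

(** If [x] has a nonzero A-component, it is the image under the first [S] of [e + c *: e2]. So its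
    transvections are conjugates, within [P], of elements of the first [M]. *)
Lemma tau_P x c a : pW s e f x = c *: e2 -> P (tv s x a) /\ T x a = f0 (tv s x a).
Proof.
have [_ PM PV] := gen_group (V := V) (fun x => slimM s n.+1 h 0 x \/ slimS s n.+1 h 0 x).
move=> xc; have [p0|p0] := eqVneq (pA s e f x) 0.
  have -> : x = 0 *: e + c *: e2 by rewrite -(pAW s e f x) p0 xc scale0r.
  split; first exact/gen2l/slimM0_tv.
  rewrite /T (tau_perp hs ef f0_torus) ?f1_M0 //.
  by rewrite !E (proj1 e2W); ring.
have [g [Kg ge]] := KA_trans hs ef (@pA_in _ _ _ hs e f x) p0; have [Sg gW] := Kg.
have hc : inW s e f (c *: e2) by apply: (inWZ hs); apply: e2W.
have xg : x = g (1 *: e + c *: e2) by rewrite linearD /= scale1r ge (gW _ hc) -xc pAW.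
have Pg : P g by apply/gen2r/KA_S0.
have Pt : P (tv s (1 *: e + c *: e2) a) by apply/gen2l/slimM0_tv.
rewrite xg -(tvJ hs) //; split; first exact: (PM _ _ (PM _ _ Pg Pt) (PV _ Pg)).
rewrite (homJ hs P_Sp (gen_group _) P_hom) // /T.
rewrite (tau_KA hs ef KA_hom f0_f1_comm f0_torus) // (tau_perp hs ef f0_torus) ?f1_M0 //.
by rewrite !E (proj1 e2W); ring.
Qed.

(** Once [KW] has moved the W-component of [u] to [e2], all three transvections of the relation lie
    in [P], where [f0] is a homomorphism. *)
Lemma rel_dependent u v m : pW s e f v = m *: pW s e f u -> tau_rel s e f f0 f1 u v.
Proof.
move=> uv; have [u0|u0] := eqVneq (pW s e f u) 0.
  apply: (rel_inA hs ef KA_hom f1_hom f0_f1_comm f0_agree_e f0_torus).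
  by rewrite -(pAW s e f u) u0 addr0; apply: (pA_in hs).
have [k [Kk ku]] := KW_trans hs ef (pW_in hs ef u) e2W u0 (e_neq0 hs ef2).
apply: (rel_KW hs ef f1_hom f0_f1_comm Kk).
have ku' : pW s e f (k u) = 1 *: e2 by rewrite (pW_KW hs ef) // ku scale1r.
have kv' : pW s e f (k v) = m *: e2 by rewrite (pW_KW hs ef) // uv linearZ /= ku.
move: (k u) (k v) ku' kv' => x y hx hy c b.
have hxy : pW s e f (tv s x c y) = (m + c * s x y) *: e2.
  by rewrite (tvE hs) (pWD hs) (pWZ hs) hx hy scale1r scalerDl.
have [Px Tx] := tau_P c hx; have [Py Ty] := tau_P b hy; have [_ Txy] := tau_P b hxy.
rewrite -/(T _ _) -/(T _ _) -/(T _ _) Tx Ty Txy -(homJ hs P_Sp (gen_group _) P_hom) //.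
by rewrite (tvJ hs) //; apply: tv_Sp.
Qed.

Lemma step_ext : exists phi : 'End(V) -> H, hom_on (Sp s) phi /\ forall g, slim_gen s n.+1 h g -> phi g = f0 g.
Proof.
have relW u v : s (pW s e f u) (pW s e f v) = 0 -> tau_rel s e f f0 f1 u v.
  move=> uv; have [[m e0]|dep] := classic (exists m, pW s e f v = m *: pW s e f u).
    exact: rel_dependent e0.
  apply: (rel_indep hs ef KA_hom f1_hom f0_f1_comm f0_agree_e f0_torus rel_dependent) => // m e0.
  by apply: dep; exists m.
have [|phi [hphi phi1 phiA phit]] := two_block_extension hs ef KA_hom f1_hom f0_f1_comm f0_agree_e f0_torus relW rel_dependent.
  by move=> u v w; apply: (common_perp_ex hs sys); lia.
have hM0 : hom_on (slimM s n.+1 h 0) f0.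
  by have [_ [hM _ _ _]] := f0_hom; apply: hM; lia.
exists phi; split=> // g [[[|j] jn hg]|[[|i] im hg]].
- by apply/phiA/KA_S0.
- have Kg := slimS_KW (e := e) (f := f) erefl erefl hg.
  by rewrite (phi1 _ (KW_G1 Kg)) f1_KW // (fW_S _ hg).
- have [Sg he hf] := hg.
  (* These are the basis vectors fixed by the first [M]. Their common orthogonal is spanned by [e]
     and [e2], so this [M] is generated by the transvections covered by [f1_M0]. *)
  pose X := [seq h (2 * k)%N | k <- iota 0 n.+1] ++ [seq h (2 * k).+1 | k <- iota 2 n.-1].
  have gX z : z \in <<X>>%VS -> g z = z.
    move=> zX; suff: z \in lker (g - \1%VF) by rewrite memv_ker !lfunE /= opp_lfunE id_lfunE subr_eq0 => /eqP.
    move: zX; apply/subvP; apply/span_subvP => x.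
    rewrite memv_ker !lfunE /= opp_lfunE id_lfunE subr_eq0 mem_cat.
    case/orP=> /mapP[k]; rewrite mem_iota => hk ->; apply/eqP; first by apply: he; lia.
    by apply: hf; lia.
  have := Sp_generated hs Sg gX.
  case/(TG_agree hs (Sp_group hs) (slimM_group n.+1 h hs 0) hphi hM0) => // x a hx.
  have hx1 k : (k < n.+1)%N -> s (h (2 * k)%N) x = 0.
    move=> kn; apply: (sC0 hs); apply: hx; apply: memv_span; rewrite mem_cat; apply/orP; left.
    by apply/mapP; exists k => //; rewrite mem_iota.
  have hx2 k : (1 < k < n.+1)%N -> s (h (2 * k).+1) x = 0.
    move=> kn; apply: (sC0 hs); apply: hx; apply: memv_span; rewrite mem_cat; apply/orP; right.
    by apply/mapP; exists k => //; rewrite mem_iota; lia.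
  have ex : x = s x f *: e + s x f2 *: e2.
    have hw : inW s e2 f2 (pW s e2 f2 x) by apply: (pW_in hs ef2).
    have x2 : pA s e2 f2 x = s x f2 *: e2 by rewrite pAE (hx1 1) ?scale0r ?addr0; last lia.
    have : pW s e2 f2 x = pA s e f (pW s e2 f2 x).
      apply: (perp_pair hs sys (j := 0)) => // k kn k0; have [k1|k1] := eqVneq k./2 1%N.
        have [w2 w3] := hw; have [kk|kk] : k = 2 \/ k = 3 by lia.
          by rewrite kk.
        by rewrite kk.
      rewrite pWE x2 !E (pair0 hs sys) ?mulr0 ?subr0 //; try lia.
      have [kk|kk] : k = (2 * k./2)%N \/ k = (2 * k./2).+1 by lia.
        by rewrite kk; apply: hx1; lia.
      by rewrite kk; apply: hx2; lia.
    rewrite pAE pWE x2 !E (hx1 0) // (proj1 e2W).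
    have -> : s e2 f = 0 by apply: (sC0 hs); case: e2W.
    by rewrite !mulr0 subrr scale0r subr0 addr0 => /eqP; rewrite subr_eq => /eqP.
  split; first exact: (tv_Sp hs); first by rewrite ex; apply: slimM0_tv.
  by rewrite phi1 ex ?f1_M0 //; apply: (tv_G1 hs); rewrite !E (proj1 e2W); ring.
- have Kg := slimM_KW (e := e) (f := f) erefl erefl hg.
  by rewrite (phi1 _ (KW_G1 Kg)) f1_KW // (fW_M _ hg).
Qed.
End Ext.
End Step.

(** * Completions *)

(** The three claims are proved together since the extension step uses both kinds of generation for
    W. With one hyperbolic pair, the only [S] subgroup is already Sp(V). *)
Theorem slim_presentation (F : fieldType) n (V : vectType F) (s : V -> V -> F) (h : nat -> V) :
  symplectic_form s -> hyperbolic_system s n.+1 h ->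
  [/\ forall g, Sp s g -> gen_by (@lmul F V) lone (@linv F V) (slim_gen s n.+1 h) g,
      forall g, Sp s g -> g (h 0) = h 0 ->
        gen_by (@lmul F V) lone (@linv F V) (slim_stab_gen s n.+1 h) g &
      (exists z : F, z != 0 /\ z != 1) -> forall (H : abs_group) (f : 'End(V) -> H),
        slim_hom s n.+1 h f -> exists phi : 'End(V) -> H, hom_on (Sp s) phi /\
          forall g, slim_gen s n.+1 h g -> phi g = f g].
Proof.
elim: n V s h => [|n IH] V s h hs sys.
  have S0 g : Sp s g -> slimS s 1 h 0 g by move=> Sg; split=> // -[].
  split=> [g Sg|g Sg ge|_ H f [hS _]].
  - by apply: gen_in; left; exists 0; last exact: S0.
  - have [G1 GM GV] := gen_group (V := V) (slim_stab_gen s 1 h).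
    apply: TG_ind (perp_TG hs Sg ge) => [|x a ex]; first by split.
    apply: gen_in; constructor 3; exists (s x (h 1) ^+ 2 * a).
    rewrite -(tvZ hs) {1}(perp_pair hs sys (j := 0) (v := x)) ?pAE //; last by move=> [|[]].
    by rewrite [s (h (2 * 0)) x]ex scale0r addr0.
  - exists f; split=> [g k /S0 ? /S0 ?|//]; exact: (hS 0).
have hs' := subform_symplectic hs (ef01 sys).
have sys' := sub_system hs (ef01 sys) erefl erefl sys.
have [IH1 IH2 IH3] := IH _ _ _ hs' sys'.
split=> [g Sg|g Sg ge|big H f hf].
- exact: (step_gen hs (ltn0Sn n) sys IH1).
- exact: (step_stab hs (ltn0Sn n) sys IH1).
have [phi' [hphi' phi'E]] := IH3 big _ _ (ext_slim_hom hs (ef01 sys) erefl erefl sys hf).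
exact: (step_ext hs (ltn0Sn n) sys IH1 IH2 big hf hphi' phi'E).
Qed.

Lemma parabolic_completion (F : fieldType) (V : vectType F) (s : V -> V -> F) n (h : nat -> V) :
  (2 <= n)%N -> symplectic_form s -> hyperbolic_basis s n h ->
  universal_completion (@lmul F V) lone (@linv F V) (Sp s) (parabolic_amalgam s n h).
Proof.
move=> n2 hs hb; have sys := basis_system hs hb.
have span_h : (<<mkseq h (2 * n)>> = fullv)%VS by apply: span_basis (proj1 hb).
split=> [g Sg|H f hf].
  apply: (gen_mono _ (stab_generate hs n2 sys Sg)) => x [k hk Px].
  by exists (exist _ k hk).
have [k hk g k' Pg Pk'|phi [hphi phiE]] := @stab_extend _ _ _ hs _ _ n2 sys span_h H f.
  exact: (hf (exist _ k hk)).
by exists phi; split=> // -[k hk] x; apply: phiE.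
Qed.

Lemma gen_agree (F : fieldType) (V : vectType F) (s : V -> V -> F) (H : abs_group)
    (A : 'End(V) -> Prop) (phi f : 'End(V) -> H) g :
  symplectic_form s -> (forall x, A x -> Sp s x) -> hom_on (Sp s) phi ->
  hom_on (gen_by (@lmul F V) lone (@linv F V) A) f -> (forall x, A x -> phi x = f x) ->
  gen_by (@lmul F V) lone (@linv F V) A g -> phi g = f g.
Proof.
move=> hs AS hphi hf AE; have GS x : gen_by (@lmul F V) lone (@linv F V) A x -> Sp s x.
  by apply: gen_le; [exact: Sp_group | exact: AS].
have Gg := gen_group A; have Sg := Sp_group hs.
elim=> [x /AE//||x y hx ex hy ey|x hx ex].
- by rewrite (hom1 Sg hphi) (hom1 Gg hf).
- by rewrite hphi ?hf // ?ex ?ey //; apply: GS.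
- by rewrite (homV hs _ Sg hphi) ?(homV hs GS Gg hf) ?ex //; apply: GS.
Qed.

(** The extension agrees with [f] on the rank one members by construction. On a rank two member [f]
    is itself a homomorphism, so [gen_agree] applies. *)
Lemma pi_completion (F : fieldType) (V : vectType F) (s : V -> V -> F) n (h : nat -> V) :
  (exists x : F, x != 0 /\ x != 1) -> (0 < n)%N -> symplectic_form s -> hyperbolic_basis s n h ->
  universal_completion (@lmul F V) lone (@linv F V) (Sp s) (pi_amalgam s n h).
Proof.
case: n => // n big _ hs hb; have sys := basis_system hs hb.
have [gen_slim _ ext_slim] := slim_presentation hs sys.
have SE j g (jn : (j < n.+1)%N) := S_pi_slim hs sys g jn.
have ME i g (im : (i.+1 < n.+1)%N) := M_pi_slim hs sys g im.
split=> [g /gen_slim|H f hf].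
  apply: gen_mono => x [[j jn /(SE _ _ jn)]|[i im /(ME _ _ im)]] hx.
    by exists (exist (pi_valid n.+1) (PiS j) jn).
  by exists (exist (pi_valid n.+1) (PiM i) im).
have hom_a a (va : pi_valid n.+1 a) : hom_on (pi_amalgam s n.+1 h (exist _ a va)) f.
  exact: hf (exist _ a va).
have sub2 (A A' B B' : 'End(V) -> Prop) : (forall x, A x <-> A' x) -> (forall x, B x <-> B' x) ->
    hom_on (gen2 A B) f -> hom_on (gen2 A' B') f.
  move=> AA BB hAB x y hx hy; apply: hAB; [move: hx | move: hy];
  apply: gen_mono => z [/AA|/BB] ?; by [left | right].
have slim_f : slim_hom s n.+1 h f.
  split=> [j jn|]; last split=> [i im|j l jn ln jl|i k im km ik|i j im jn].
  - by move=> x y /(SE _ _ jn) hx /(SE _ _ jn) hy; apply: (hom_a (PiS j)).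
  - by move=> x y /(ME _ _ im) hx /(ME _ _ im) hy; apply: (hom_a (PiM i)).
  - apply: (sub2 _ _ _ _ (fun x => SE j x jn) (fun x => SE l x ln)).
    by apply: (hom_a (PiSS j l)); rewrite /= jn ln.
  - apply: (sub2 _ _ _ _ (fun x => ME i x im) (fun x => ME k x km)).
    by apply: (hom_a (PiMM i k)); rewrite /= im km.
  - apply: (sub2 _ _ _ _ (fun x => ME i x im) (fun x => SE j x jn)).
    by apply: (hom_a (PiQ i j)); rewrite /= im jn.
have [phi [hphi phiE]] := ext_slim big H f slim_f.
have phiS j x : (j < n.+1)%N -> S_pi s n.+1 h j x -> phi x = f x.
  by move=> jn /(SE _ _ jn) hx; apply: phiE; left; exists j.
have phiM i x : (i.+1 < n.+1)%N -> M_pi s n.+1 h i x -> phi x = f x.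
  by move=> im /(ME _ _ im) hx; apply: phiE; right; exists i.
have Ssp j x : S_pi s n.+1 h j x -> Sp s x by case.
have Msp i x : M_pi s n.+1 h i x -> Sp s x by case.
exists phi; split=> // -[a va] x; have := hom_a a va; case: a va => [j|i|j l|i k|i j] va homa.
- exact: phiS.
- exact: phiM.
- have [jn ln _] := and3P va.
  by apply: (gen_agree hs _ hphi homa) => y [hy|hy]; eauto.
- have [im km _] := and3P va.
  by apply: (gen_agree hs _ hphi homa) => y [hy|hy]; eauto.
- have [im jn] := andP va.
  by apply: (gen_agree hs _ hphi homa) => y [hy|hy]; eauto.
Qed.

Theorem theorem1p1 (F : fieldType) (V : vectType F) (n : nat)
  (s : V -> V -> F) (h : nat -> V) :
  (2 <= n)%N ->
  \dim (fullv : {vspace V}) = (2 * n)%N ->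
  symplectic_form s ->
  hyperbolic_basis s n h ->
  ((exists x : F, x != 0 /\ x != 1) ->
     universal_completion (@lmul F V) (@lone F V) (@linv F V)
       (Sp s) (pi_amalgam s n h)) /\
  universal_completion (@lmul F V) (@lone F V) (@linv F V)
    (Sp s) (parabolic_amalgam s n h).
Proof.
move=> n2 _ hs hb; split=> [big|]; last exact: parabolic_completion.
by apply: pi_completion => //; apply: leq_trans n2.
Qed.
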